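(* Let $A$ be an associative unital ring and let $\mathcal{C}$ be a coseparable $A$-coring with a cointegral $\gamma$ and a grouplike element $g$. View $\mathcal{C}$ as a separable $A$-ring with the product $cc'=\sum\gamma(c\otimes c'_{(1)})c'_{(2)}=\sum c_{(1)}\gamma(c_{(2)}\otimes c')$, and let $\mathbf{M}_{\mathcal{C}}$ be the category of firm right modules of the $A$-ring $\mathcal{C}$. View $A$ as a right $\mathcal{C}$-module with action $a\cdot c=\gamma(ga\otimes c)$. For any $M\in\mathbf{M}_{\mathcal{C}}$ define $$M^{\mathcal{C}}_{g,\gamma}=\{m\in M\;|\;\forall c\in\mathcal{C},\ m\cdot c=m\gamma(g\otimes c)\}.$$ Then: (1) $B=A^{\mathcal{C}}_{g,\gamma}=\{b\in A\;|\;\forall c\in\mathcal{C},\ \gamma(gb\otimes c)=b\gamma(g\otimes c)\}$ is a subring of $A$. (2) The assignment $(-)^{\mathcal{C}}_{g,\gamma}:\mathbf{M}_{\mathcal{C}}\to\mathbf{M}_B$, $M\mapsto M^{\mathcal{C}}_{g,\gamma}$, is a covariant functor which has a left adjoint $-\otimes_B A:\mathbf{M}_B\to\mathbf{M}_{\mathcal{C}}$. (3) $Q=\mathcal{C}^{\mathcal{C}}_{g,\gamma}$ is a firm left ideal in $\mathcal{C}$ (i.e. a left ideal which is firm as a left $\mathcal{C}$-module) and hence a $(\mathcal{C},B)$-bimodule. (4) For every $M\in\mathbf{M}_{\mathcal{C}}$, the additive map $\omega_M:M\otimes_{\mathcal{C}}Q\to M^{\mathcal{C}}_{g,\gamma}$,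 $m\otimes q\mapsto m\cdot q$, is bijective. (5) Define two maps $\sigma:Q\otimes_B A\to\mathcal{C}$, $q\otimes a\mapsto qa$, and $\tau:A\otimes_{\mathcal{C}}Q\to B$, $a\otimes q\mapsto\gamma(ga\otimes q)$. Then $(B,\mathcal{C},A,Q,\tau,\sigma)$ is a Morita context, in which $\tau$ is surjective (hence an isomorphism).
   Context: Corings. $A$ is an associative ring with unit. An $A$-coring is an $(A,A)$-bimodule $\mathcal{C}$ with $(A,A)$-bimodule maps $\Delta_{\mathcal{C}}:\mathcal{C}\to\mathcal{C}\otimes_A\mathcal{C}$, written $\Delta_{\mathcal{C}}(c)=\sum c_{(1)}\otimes c_{(2)}$, and $\epsilon_{\mathcal{C}}:\mathcal{C}\to A$, satisfying coassociativity and counitality. It is coseparable if $\Delta_{\mathcal{C}}$ has a $(\mathcal{C},\mathcal{C})$-bicomodule retraction $\pi:\mathcal{C}\otimes_A\mathcal{C}\to\mathcal{C}$. Such $\pi$ correspond bijectively to cointegrals, i.e. $(A,A)$-bimodule maps $\gamma:\mathcal{C}\otimes_A\mathcal{C}\to A$ such that for all $c,c'\in\mathcal{C}$, $\sum\gamma(c\otimes c'_{(1)})c'_{(2)}=\sum c_{(1)}\gamma(c_{(2)}\otimes c')$ and $\sum\gamma(c_{(1)}\otimes c_{(2)})=\epsilon_{\mathcal{C}}(c)$, via $\gamma=\epsilon_{\mathcal{C}}\circ\pi$, $\pi(c\otimes c')=\sum c_{(1)}\gamma(c_{(2)}\otimes c')$. A grouplike element is $g\in\mathcal{C}$ with $\Delta_{\mathcal{C}}(g)=g\otimes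 g$ and $\epsilon_{\mathcal{C}}(g)=1_A$. $A$-rings and modules. An $A$-ring is an $(A,A)$-bimodule $S$ with an associative $(A,A)$-bimodule map $S\otimes_A S\to S$ (no unit required); it is separable if the product has an $(S,S)$-bimodule section. For a coseparable coring with cointegral $\gamma$, the product $\pi$ above makes $\mathcal{C}$ a separable $A$-ring. A right module over an $A$-ring $S$ is a right $A$-module $M$ with a right $A$-module map $M\otimes_A S\to M$, $m\otimes s\mapsto m\cdot s$, that is associative; morphisms are right $A$-linear maps commuting with the action. Left modules and bimodules are defined similarly. For a right $S$-module $M$ and a left $S$-module $N$, $M\otimes_S N$ is the cokernel of $M\otimes_A S\otimes_A N\to M\otimes_A N$, $m\otimes s\otimes n\mapsto m\cdot s\otimes n-m\otimes s\cdot n$. A right $S$-module $M$ is firm if the induced map $M\otimes_S S\to M$ is an isomorphism of right $S$-modules; similarly on the left. A non-unital ring is firm if it is firm as a left and right module over itself. $\mathbf{M}_B$ is the category of right modules over the (unital) ring $B$; the right $\mathcal{C}$-action on $N\otimes_B A$ is $(n\otimes a)\cdot c=n\otimes\gamma(ga\otimes c)$. Morita contexts. Given firm non-unital rings $R,S$, a Morita context $(R,S,V,W,\tau,\sigma)$ consists of a firm $(R,S)$-bimodule $V$, a firm $(S,R)$-bimodule $W$, and bimodule maps $\sigma:W\otimes_R V\to S$, $\tau:V\otimes_S W\to R$ such that, for all $v,v'\in V$ and $w,w'\in W$, $\sigma(w\otimes v)w'=w\,\tau(v\otimes w')$ and $\tau(v\otimes w)v'=v\,\sigma(w\otimes v')$.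 *)

(* Defs.v *)
From HB Require Import structures.
From mathcomp Require Import all_boot all_algebra.
From mathcomp.multinomials Require Import freeg.
From mathcomp Require Import boolp.

Set Implicit Arguments.
Unset Strict Implicit.
Unset Printing Implicit Defensive.

Import GRing.Theory.
Local Open Scope ring_scope.

Section GeneratedQuotient.
Variables (G : zmodType) (P : G -> Prop).

(* The subgroup generated by P; zquot is the quotient by it. *)
Definition zgen : {pred G} := [pred x | `[<
  forall H : {pred G}, zmod_closed H -> (forall y, P y -> y \in H) -> x \in H >]].

Lemma zgenP x : reflect
  (forall H : {pred G}, zmod_closed H -> (forall y, P y -> y \in H) -> x \in H)
  (x \in zgen).
Proof. exact: asboolP. Qed.

Lemma zgen_incl x : P x -> x \in zgen.
Proof. by move=> Px; apply/zgenP => H _; apply. Qed.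

Lemma zgen_closed : zmod_closed zgen.
Proof.
split=> [|x y /zgenP xP /zgenP yP]; apply/zgenP=> H HH sPH; first by case: HH.
by case: (HH) => _; apply; [exact: xP | exact: yP].
Qed.

HB.instance Definition _ := GRing.isZmodClosed.Build G zgen zgen_closed.

Definition zquot : Type := Quotient.quot zgen.
HB.instance Definition _ := GRing.Zmodule.on zquot.

Definition zpi (x : G) : zquot := (\pi_(Quotient.quot zgen) x)%qT.

Lemma zpi_is_zmod_morphism : zmod_morphism zpi.
Proof. by move=> x y; rewrite /zpi /GRing.add/= !raddfB. Qed.
HB.instance Definition _ := GRing.isZmodMorphism.Build G zquot zpi
  zpi_is_zmod_morphism.

Lemma zpi_surj (x : zquot) : exists y, x = zpi y.
Proof. by exists (repr (x : Quotient.quot zgen)); rewrite /zpi reprK. Qed.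

Lemma zpi_eq0 x : P x -> zpi x = 0.
Proof.
move=> Px; rewrite -(raddf0 zpi); apply/eqP.
by rewrite /zpi -Quotient.idealrBE subr0 zgen_incl.
Qed.

Variables (H : zmodType) (f : G -> H).

Definition zlift (x : zquot) : H := f (repr (x : Quotient.quot zgen)).

Hypothesis f_add : zmod_morphism f.
Hypothesis f_P : forall x, P x -> f x = 0.

Lemma zliftE x : zlift (zpi x) = f x.
Proof.
have fB y z : f (y - z) = f y - f z by apply: f_add.
apply/eqP; rewrite -subr_eq0 -fB.
have /zgenP : repr (zpi x : Quotient.quot zgen) - x \in zgen.
  by rewrite Quotient.idealrBE; apply/eqP; rewrite reprK.
move=> /(_ [pred y | f y == 0]); rewrite inE fB; apply=> [|y /f_P fy].
  2: by rewrite inE fy.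
split=> [|y z]; rewrite !inE.
  by have /eqP := fB 0 0; rewrite !subrr.
by move=> /eqP fy /eqP fz; rewrite fB fy fz subrr.
Qed.

Lemma zlift_is_zmod_morphism : zmod_morphism zlift.
Proof.
move=> x y; have [x' ->] := zpi_surj x; have [y' ->] := zpi_surj y.
by rewrite -raddfB !zliftE f_add.
Qed.
End GeneratedQuotient.

HB.mixin Record isRmodule (R : pzRingType) V of GRing.Zmodule V := {
  rscale : V -> R -> V;
  rscaleA : forall v a b, rscale (rscale v a) b = rscale v (a * b);
  rscaler1 : forall v, rscale v 1 = v;
  rscaleDl : forall a, {morph rscale^~ a : u v / u + v};
  rscaleDr : forall v, {morph rscale v : a b / a + b}
}.
#[short(type="rmodType")]
HB.structure Definition Rmodule (R : pzRingType) :=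
  {V of isRmodule R V & GRing.Zmodule V}.

Notation "v :* a" := (rscale v a) (at level 40) : ring_scope.

HB.mixin Record isBimodule (R S : pzRingType) V
    of GRing.Lmodule R V & Rmodule S V := {
  scale_rscaleA : forall (a : R) (v : V) (b : S), a *: (v :* b) = (a *: v) :* b
}.
#[short(type="bimodType")]
HB.structure Definition Bimodule (R S : pzRingType) :=
  {V of isBimodule R S V & GRing.Lmodule R V & Rmodule S V}.

Section RmoduleTheory.
Variables (R : pzRingType) (V : rmodType R).
Implicit Types (u v : V) (a b : R).

Lemma rscale_is_zmod_morphism a : zmod_morphism (fun v : V => v :* a).
Proof.
by move=> u v; apply: (addIr (v :* a)); rewrite -(rscaleDl a (u - v)) !subrK.
Qed.
Lemma rscaleBl u v a : (u - v) :* a = u :* a - v :* a.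
Proof. exact: rscale_is_zmod_morphism. Qed.
Lemma rscale0r a : (0 : V) :* a = 0.
Proof. by have := rscaleBl 0 0 a; rewrite !subrr. Qed.
Lemma rscaleBr v a b : v :* (a - b) = v :* a - v :* b.
Proof. by apply: (addIr (v :* b)); rewrite -rscaleDr !subrK. Qed.
Lemma rscaler0 v : v :* 0 = 0.
Proof. by have := rscaleBr v 0 0; rewrite !subrr. Qed.
End RmoduleTheory.

HB.instance Definition _ (R : pzRingType) :=
  isRmodule.Build R R^o (fun v a b => esym (mulrA v a b)) (@mulr1 R)
    (fun a u v => mulrDl u v a) (@mulrDr R).
HB.instance Definition _ (R : pzRingType) :=
  isBimodule.Build R R R^o (@mulrA R).

(* M (x)_R N as the free abelian group on M * N modulo the bilinear and
   balancing relations. *)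

Section Tensor.
Variables (R : pzRingType) (M : rmodType R) (N : lmodType R).

Local Notation "<[ m , n ]>" := (<< (m, n) >> : {freeg (M * N)}).

Inductive tensor_rel : {freeg (M * N)} -> Prop :=
| TensorRelDl m m' n : tensor_rel (<[m + m', n]> - <[m, n]> - <[m', n]>)
| TensorRelDr m n n' : tensor_rel (<[m, n + n']> - <[m, n]> - <[m, n']>)
| TensorRelA m a n : tensor_rel (<[m :* a, n]> - <[m, a *: n]>).

Definition tensor : Type := zquot tensor_rel.
HB.instance Definition _ := GRing.Zmodule.on tensor.

Definition tens (m : M) (n : N) : tensor := zpi tensor_rel <[m, n]>.

Definition balanced (G : zmodType) (f : M -> N -> G) : Prop :=
  [/\ forall n, {morph f^~ n : m m' / m + m'},
      forall m, {morph f m : n n' / n + n'}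
    & forall m a n, f (m :* a) n = f m (a *: n)].

(* tlift f is the map induced on the tensor product by m (x) n |-> f m n; it is
   total in f, and meaningful when f is balanced (tliftE, tlift_additive). *)
Definition tlift (G : zmodType) (f : M -> N -> G) : tensor -> G :=
  zlift (fglift (fun p : M * N => f p.1 p.2 : zmodule G)).

Lemma tensDl m m' n : tens (m + m') n = tens m n + tens m' n.
Proof.
apply/eqP; rewrite -subr_eq0 opprD addrA /tens -!raddfB; apply/eqP/zpi_eq0.
exact: TensorRelDl.
Qed.
Lemma tensDr m n n' : tens m (n + n') = tens m n + tens m n'.
Proof.
apply/eqP; rewrite -subr_eq0 opprD addrA /tens -!raddfB; apply/eqP/zpi_eq0.
exact: TensorRelDr.
Qed.
Lemma tensA m a n : tens (m :* a) n = tens m (a *: n).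
Proof.
apply/eqP; rewrite -subr_eq0 /tens -raddfB; apply/eqP/zpi_eq0; exact: TensorRelA.
Qed.

Section Lift.
Variables (G : zmodType) (f : M -> N -> G) (fP : balanced f).
Let ff := fglift (fun p : M * N => f p.1 p.2 : zmodule G).
Let ffB : zmod_morphism (ff : _ -> G).
Proof. move=> x y; exact: (@lift_is_additive _ _ (zmodule G)). Qed.
Let ffE m n : ff <[m, n]> = f m n.
Proof. by rewrite /ff liftU scale1r. Qed.
Let ff0 x : tensor_rel x -> ff x = 0 :> G.
Proof.
have [fDl fDr fA] := fP.
have B y z : ff (y - z) = ff y - ff z :> G by exact: ffB.
case=> *; rewrite !B !ffE; last by rewrite fA subrr.
  by rewrite fDl addrAC addrK subrr.
by rewrite fDr addrAC addrK subrr.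
Qed.

Lemma tliftE m n : tlift f (tens m n) = f m n.
Proof. by rewrite /tlift /tens zliftE //; apply: ffE. Qed.
Lemma tlift_additive : zmod_morphism (tlift f).
Proof. exact: zlift_is_zmod_morphism. Qed.
End Lift.

Lemma tensor_ind (P : tensor -> Prop) :
    (forall m n, P (tens m n)) ->
    (forall s t, P s -> P t -> P (s - t)) -> forall t, P t.
Proof.
move=> Pt PB t; have [x ->] := zpi_surj t.
have P0 : P 0 by rewrite -(subrr (tens 0 0)); apply: PB.
have PN s : P s -> P (- s) by move=> Ps; rewrite -sub0r; apply: PB.
have PD s s' : P s -> P s' -> P (s + s').
  by move=> Ps Ps'; rewrite -[s']opprK; apply/PB/PN.
have PM s n : P s -> P (s *+ n).
  by move=> Ps; elim: n => [|n IH]; rewrite ?mulr0n ?mulrS //; apply: PD.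
pose q := zpi tensor_rel.
rewrite -(Freeg_dom x); elim: [seq _ | _ <- _] => [|[k [m n]] s IH].
  by rewrite freeg_nil raddf0.
rewrite -cat1s freeg_cat raddfD; apply: PD => //.
have -> : << k *g (m, n) >> = << (m, n) >> *~ k :> {freeg (M * N)}.
  by rewrite freeg_mulz intz.
rewrite raddfMz.
by case: k => k; rewrite ?NegzE ?mulrNz; [|apply: PN]; apply: PM; apply: Pt.
Qed.

Lemma tensor_ext (G : zmodType) (f h : tensor -> G) :
    zmod_morphism f -> zmod_morphism h ->
  (forall m n, f (tens m n) = h (tens m n)) -> f =1 h.
Proof.
move=> fB hB E; elim/tensor_ind => [//|s t IHs IHt].
by rewrite (fB s t) (hB s t) IHs IHt.
Qed.
End Tensor.

Arguments tensor {R} M N.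
Notation "m ⊗ n" := (tens m n) (at level 40, no associativity) : ring_scope.

Lemma zmod_morphism_morph (G H : zmodType) (f : G -> H) :
  zmod_morphism f -> {morph f : x y / x + y}.
Proof. by move=> fB x y; apply: (addIr (- f y)); rewrite -fB !addrK. Qed.

Section TensorLeft.
Variables (S R : pzRingType) (M : bimodType S R) (N : lmodType R).

Definition tscale (a : S) : tensor M N -> tensor M N :=
  tlift (fun (m : M) (n : N) => (a *: m) ⊗ n).

Lemma tscale_balanced a :
  balanced (fun (m : M) (n : N) => (a *: m) ⊗ n : tensor M N).
Proof.
split=> [n m m'|m n n'|m b n]; rewrite ?scalerDr ?tensDl ?tensDr //.
by rewrite scale_rscaleA tensA.
Qed.
Lemma tscaleE a (m : M) (n : N) : tscale a (m ⊗ n) = (a *: m) ⊗ n.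
Proof. by rewrite /tscale tliftE //; apply: tscale_balanced. Qed.
Lemma tscaleB a : zmod_morphism (tscale a).
Proof. exact/tlift_additive/tscale_balanced. Qed.

Lemma tscaleA a b t : tscale a (tscale b t) = tscale (a * b) t.
Proof.
elim/tensor_ind: t => [m n|s t IHs IHt]; last by rewrite !tscaleB IHs IHt.
by rewrite !tscaleE scalerA.
Qed.
Lemma tscale1 : left_id 1 tscale.
Proof.
elim/tensor_ind => [m n|s t IHs IHt]; last by rewrite !tscaleB IHs IHt.
by rewrite !tscaleE scale1r.
Qed.
Lemma tscaleDr : right_distributive tscale +%R.
Proof. by move=> a; exact/zmod_morphism_morph/tscaleB. Qed.
Lemma tscaleDl t : {morph tscale^~ t : a b / a + b}.
Proof.
move=> a b; elim/tensor_ind: t => [m n|s t IHs IHt].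
  by rewrite !tscaleE scalerDl tensDl.
by rewrite !tscaleB IHs IHt opprD addrACA.
Qed.

HB.instance Definition _ := GRing.Zmodule_isLmodule.Build S (tensor M N)
  tscaleA tscale1 tscaleDr tscaleDl.

Lemma tensZ a (m : M) (n : N) : a *: (m ⊗ n : tensor M N) = (a *: m) ⊗ n.
Proof. exact: tscaleE. Qed.
End TensorLeft.

Section TensorRight.
Variables (R S : pzRingType) (M : rmodType R) (N : bimodType R S).

Definition trscale (t : tensor M N) (b : S) : tensor M N :=
  tlift (fun (m : M) (n : N) => m ⊗ (n :* b)) t.

Lemma trscale_balanced b :
  balanced (fun (m : M) (n : N) => m ⊗ (n :* b) : tensor M N).
Proof.
split=> [n m m'|m n n'|m a n]; rewrite ?rscaleDl ?tensDl ?tensDr //.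
by rewrite -scale_rscaleA tensA.
Qed.
Lemma trscaleE (m : M) (n : N) b : trscale (m ⊗ n) b = m ⊗ (n :* b).
Proof. by rewrite /trscale tliftE //; apply: trscale_balanced. Qed.
Lemma trscaleB b : zmod_morphism (trscale^~ b).
Proof. exact/tlift_additive/trscale_balanced. Qed.
Let B s t b : trscale (s - t) b = trscale s b - trscale t b.
Proof. exact: trscaleB. Qed.

Lemma trscaleA t a b : trscale (trscale t a) b = trscale t (a * b).
Proof.
elim/tensor_ind: t => [m n|s t IHs IHt]; last by rewrite !B IHs IHt.
by rewrite !trscaleE rscaleA.
Qed.
Lemma trscale1 t : trscale t 1 = t.
Proof.
elim/tensor_ind: t => [m n|s t IHs IHt]; last by rewrite !B IHs IHt.
by rewrite !trscaleE rscaler1.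
Qed.
Lemma trscaleDl b : {morph trscale^~ b : s t / s + t}.
Proof. exact/zmod_morphism_morph/trscaleB. Qed.
Lemma trscaleDr t : {morph trscale t : a b / a + b}.
Proof.
move=> a b; elim/tensor_ind: t => [m n|s t IHs IHt].
  by rewrite !trscaleE rscaleDr tensDr.
by rewrite !B IHs IHt opprD addrACA.
Qed.

HB.instance Definition _ := isRmodule.Build S (tensor M N)
  trscaleA trscale1 trscaleDl trscaleDr.

Lemma tens_rscale (m : M) (n : N) b : (m ⊗ n : tensor M N) :* b = m ⊗ (n :* b).
Proof. exact: trscaleE. Qed.
End TensorRight.

Section TensorBimodule.
Variables (S R T : pzRingType) (M : bimodType S R) (N : bimodType R T).

Lemma tensor_scale_rscaleA (a : S) (t : tensor M N) (b : T) :
  a *: (t :* b) = (a *: t) :* b.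
Proof.
elim/tensor_ind: t => [m n|s t IHs IHt].
  by rewrite tensZ !tens_rscale tensZ.
by rewrite rscaleBl !scalerBr rscaleBl IHs IHt.
Qed.
HB.instance Definition _ := isBimodule.Build S T (tensor M N)
  tensor_scale_rscaleA.
End TensorBimodule.

Section TensorMaps.
Variables (R : pzRingType) (M M' : rmodType R) (N N' : lmodType R).

(* Meaningful for f right R-linear and h left R-linear. *)
Definition tmap (f : M -> M') (h : N -> N') : tensor M N -> tensor M' N' :=
  tlift (fun m n => f m ⊗ h n).

Lemma tmap_balanced (f : M -> M') (h : N -> N') :
    zmod_morphism f -> zmod_morphism h ->
    (forall x a, f (x :* a) = f x :* a) -> (forall a x, h (a *: x) = a *: h x) ->
  balanced (fun m n => f m ⊗ h n).
Proof.
move=> /zmod_morphism_morph fD /zmod_morphism_morph hD fZ hZ.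
by split=> [n m m'|m n n'|m a n];
  rewrite ?fD ?hD ?tensDl ?tensDr ?fZ ?hZ ?tensA.
Qed.
End TensorMaps.

Section Associator.
Variables (R S : pzRingType) (M : rmodType R) (N : bimodType R S).
Variable (P : lmodType S).

Definition tassoc : tensor (tensor M N) P -> tensor M (tensor N P) :=
  tlift (fun (t : tensor M N) (p : P) =>
    tlift (fun (m : M) (n : N) => m ⊗ (n ⊗ p : tensor N P)) t).

Definition tassoc_inv : tensor M (tensor N P) -> tensor (tensor M N) P :=
  tlift (fun (m : M) (t : tensor N P) =>
    tlift (fun (n : N) (p : P) => (m ⊗ n : tensor M N) ⊗ p) t).

Lemma tassoc_balancedl (p : P) :
  balanced (fun (m : M) (n : N) => m ⊗ (n ⊗ p : tensor N P)).
Proof.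
split=> [n m m'|m n n'|m a n]; rewrite ?tensDl ?tensDr //.
by rewrite tensA tensZ.
Qed.
Lemma tassoc_balanced :
  balanced (fun (t : tensor M N) (p : P) =>
    tlift (fun (m : M) (n : N) => m ⊗ (n ⊗ p : tensor N P)) t).
Proof.
have B p := tlift_additive (tassoc_balancedl p).
split=> [p|t p p'|t a p]; first exact/zmod_morphism_morph/B.
  elim/tensor_ind: t => [m n|s t IHs IHt]; last first.
    by rewrite !B IHs IHt opprD addrACA.
  by rewrite !(tliftE (tassoc_balancedl _)) !tensDr.
elim/tensor_ind: t => [m n|s t IHs IHt]; last by rewrite rscaleBl !B IHs IHt.
by rewrite tens_rscale !(tliftE (tassoc_balancedl _)) tensA.
Qed.
Lemma tassocB : zmod_morphism tassoc.
Proof. exact/tlift_additive/tassoc_balanced. Qed.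
Lemma tassocE (m : M) (n : N) (p : P) :
  tassoc ((m ⊗ n : tensor M N) ⊗ p) = m ⊗ (n ⊗ p : tensor N P).
Proof.
by rewrite /tassoc (tliftE tassoc_balanced) (tliftE (tassoc_balancedl p)).
Qed.
End Associator.


Definition lmod_map (R : pzRingType) (M N : lmodType R) (f : M -> N) : Prop :=
  zmod_morphism f /\ forall a x, f (a *: x) = a *: f x.
Definition rmod_map (R : pzRingType) (M N : rmodType R) (f : M -> N) : Prop :=
  zmod_morphism f /\ forall x a, f (x :* a) = f x :* a.
Definition bimod_map (R S : pzRingType) (M N : bimodType R S) (f : M -> N) :
  Prop := lmod_map f /\ rmod_map f.

(* A^o is A as a bimodule over itself. *)
HB.mixin Record isCoring (A : pzRingType) C of Bimodule A A C := {
  comul : C -> tensor C C;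
  counit : C -> A;
  comul_bimod_map : bimod_map comul;
  counit_bimod_map : bimod_map (counit : C -> A^o);
  comulA : forall c,
    tassoc (tmap comul id (comul c)) = tmap id comul (comul c);
  counitl : forall c, tlift (fun x y : C => counit x *: y) (comul c) = c;
  counitr : forall c, tlift (fun x y : C => x :* counit y) (comul c) = c
}.
#[short(type="coringType")]
HB.structure Definition Coring (A : pzRingType) :=
  {C of isCoring A C & Bimodule A A C}.

Section CoringDefs.
Variables (A : pzRingType) (C : coringType A).

(* The regular bicomodule structure on C (x) C is comul (x) id on the left and
   id (x) comul on the right. *)
Definition coseparable : Prop := exists pi : tensor C C -> C,
  [/\ bimod_map pi,
      forall c, pi (comul c) = c,
      forall t, comul (pi t) = tmap id pi (tassoc (tmap comul id t))
    & forall t, comul (pi t) = tmap pi id (tassoc_inv (tmap id comul t))].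

Definition is_cointegral (gamma : tensor C C -> A) : Prop :=
  [/\ bimod_map (gamma : tensor C C -> A^o),
      forall c c' : C, tlift (fun x y : C => gamma (c ⊗ x) *: y) (comul c') =
                       tlift (fun x y : C => x :* gamma (y ⊗ c')) (comul c)
    & forall c, gamma (comul c) = counit c].

Record cointegral := Cointegral {
  cointegral_map :> tensor C C -> A;
  cointegralP : is_cointegral cointegral_map
}.

Record grouplike := Grouplike {
  grouplike_elt :> C;
  comul_grouplike : comul grouplike_elt = grouplike_elt ⊗ grouplike_elt;
  counit_grouplike : counit grouplike_elt = 1
}.
End CoringDefs.

(* Non-unital rings over A and their modules. A product or an action, a map out
   of a tensor product over A, is given as a balanced biadditive operation. *)

Record aring (A : pzRingType) := ARing {
  aring_sort :> bimodType A A;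
  amul : aring_sort -> aring_sort -> aring_sort;
  amul_balanced : balanced amul;
  amulZl : forall a s t, amul (a *: s) t = a *: amul s t;
  amulZr : forall s t a, amul s (t :* a) = amul s t :* a;
  amulA : forall s t u, amul s (amul t u) = amul (amul s t) u
}.

Section Actions.
Variables (A : pzRingType) (S : aring A).

Definition is_ract (M : rmodType A) (act : M -> S -> M) : Prop :=
  [/\ balanced act,
      forall m s a, act m (s :* a) = act m s :* a
    & forall m s t, act (act m s) t = act m (amul s t)].

Definition is_lact (N : lmodType A) (act : S -> N -> N) : Prop :=
  [/\ balanced act,
      forall a s n, act (a *: s) n = a *: act s n
    & forall s t n, act s (act t n) = act (amul s t) n].

Record rsmod := RSMod {
  rsmod_sort :> rmodType A;
  ract : rsmod_sort -> S -> rsmod_sort;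
  ractP : is_ract ract
}.

Record lsmod := LSMod {
  lsmod_sort :> lmodType A;
  lact : S -> lsmod_sort -> lsmod_sort;
  lactP : is_lact lact
}.

Lemma amul_is_ract : @is_ract S (@amul A S).
Proof. by split=> *; [exact: amul_balanced | exact: amulZr | rewrite amulA]. Qed.
Lemma amul_is_lact : @is_lact S (@amul A S).
Proof. by split=> *; [exact: amul_balanced | exact: amulZl | exact: amulA]. Qed.

Definition regr : rsmod := RSMod amul_is_ract.
Definition regl : lsmod := LSMod amul_is_lact.

(* M (x)_S N: the image of M (x)_A S (x)_A N -> M (x)_A N is the subgroup
   generated by the images of the pure tensors. *)
Section TensorS.
Variables (M : rsmod) (N : lsmod).

Inductive stensor_rel : tensor M N -> Prop :=
| STensorRel m s n : stensor_rel (ract m s ⊗ n - m ⊗ lact s n).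

Definition stensor : Type := zquot stensor_rel.
HB.instance Definition _ := GRing.Zmodule.on stensor.

Definition stens (m : M) (n : N) : stensor := zpi stensor_rel (m ⊗ n).
End TensorS.
Arguments stens {M N} & m n.

(* An additive map out of stensor is determined by its values on pure tensors;
   it is linear over S whenever it is so on these. *)
Definition firm_right (M : rsmod) : Prop :=
  exists2 f : {additive stensor M regl -> M},
    (forall (m : M) (s : S), f (stens m s) = ract m s) & bijective f.

Definition firm_left (N : lsmod) : Prop :=
  exists2 f : {additive stensor regr N -> N},
    (forall (s : S) (n : N), f (stens s n) = lact s n) & bijective f.

Definition firm_ring : Prop := firm_left regl /\ firm_right regr.

Definition left_ideal (I : {pred S}) : Prop :=
  [/\ zmod_closed I,
      forall a s, s \in I -> a *: s \in I
    & forall s t, t \in I -> amul s t \in I].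

Definition rsmod_map (M N : rsmod) (f : M -> N) : Prop :=
  rmod_map f /\ forall m s, f (ract m s) = ract (f m) s.
End Actions.
Arguments stens {A S M N} & m n.

Section SBimodules.
Variables (K L : pzRingType) (R : aring K) (S : aring L).

Record sbimod := SBimod {
  sbimod_sort :> bimodType K L;
  sb_lact : R -> sbimod_sort -> sbimod_sort;
  sb_ract : sbimod_sort -> S -> sbimod_sort;
  sb_lactP : is_lact sb_lact;
  sb_ractP : is_ract sb_ract;
  sb_lactZr : forall r v b, sb_lact r (v :* b) = sb_lact r v :* b;
  sb_ractZl : forall a v s, sb_ract (a *: v) s = a *: sb_ract v s;
  sb_actA : forall r v s, sb_ract (sb_lact r v) s = sb_lact r (sb_ract v s)
}.

Definition sb_left (V : sbimod) : lsmod R := LSMod (sb_lactP V).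
Definition sb_right (V : sbimod) : rsmod S := RSMod (sb_ractP V).

Definition sb_firm (V : sbimod) : Prop :=
  firm_left (sb_left V) /\ firm_right (sb_right V).
End SBimodules.

Section Morita.
Variables (K L : pzRingType) (R : aring K) (S : aring L).

(* An (R, R)-bimodule map V (x)_S W -> R, for V an (R, S)- and W an
   (S, R)-bimodule. *)
Record is_pairing (V : sbimod R S) (W : sbimod S R)
    (f : stensor (sb_right V) (sb_left W) -> R) : Prop := IsPairing {
  pairing_additive : zmod_morphism f;
  pairing_scale : forall a (v : V) (w : W),
    f (stens (a *: v) w) = a *: f (stens v w);
  pairing_rscale : forall (v : V) (w : W) a,
    f (stens v (w :* a)) = f (stens v w) :* a;
  pairing_lact : forall r (v : V) (w : W),
    f (stens (sb_lact r v) w) = amul r (f (stens v w));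
  pairing_ract : forall (v : V) (w : W) r,
    f (stens v (sb_ract w r)) = amul (f (stens v w)) r
}.
End Morita.

Record morita_context (K L : pzRingType) (R : aring K) (S : aring L)
    (V : sbimod R S) (W : sbimod S R)
    (tau : stensor (sb_right V) (sb_left W) -> R)
    (sigma : stensor (sb_right W) (sb_left V) -> S) : Prop := MoritaContext {
  morita_firmR : firm_ring R;
  morita_firmS : firm_ring S;
  morita_firmV : sb_firm V;
  morita_firmW : sb_firm W;
  morita_tau : is_pairing tau;
  morita_sigma : is_pairing sigma;
  morita_assocW : forall (w w' : W) (v : V),
    sb_lact (sigma (stens w v)) w' = sb_ract w (tau (stens v w'));
  morita_assocV : forall (v v' : V) (w : W),
    sb_lact (tau (stens v w)) v' = sb_ract v (sigma (stens w v'))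
}.

(* A unital ring R as a non-unital ring over the base R: the relations of
   stensor over it already hold in the tensor product over R. *)
Section RegularRing.
Variable R : pzRingType.

Lemma mul_balanced : balanced ( *%R : R^o -> R^o -> R^o).
Proof.
by split=> [n m m'|m n n'|m a n]; [exact: mulrDl|exact: mulrDr|rewrite /= mulrA].
Qed.

Definition regular_aring : aring R :=
  @ARing R R^o *%R mul_balanced (fun a s t => esym (mulrA a s t))
    (fun s t a => mulrA s t a) (@mulrA R).
End RegularRing.

Record category := Category {
  ob :> Type;
  hom : ob -> ob -> Type;
  idm : forall x, hom x x;
  compm : forall x y z, hom y z -> hom x y -> hom x z;
  compm1 : forall x y (f : hom x y), compm f (idm x) = f;
  comp1m : forall x y (f : hom x y), compm (idm y) f = f;
  compmA : forall x y z t (f : hom z t) (g : hom y z) (h : hom x y),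
    compm f (compm g h) = compm (compm f g) h
}.
Arguments idm {c} x.
Arguments compm {c x y z} f g.

Definition is_functor (C D : category) (F : C -> D)
    (Fm : forall x y, hom x y -> hom (F x) (F y)) : Prop :=
  (forall x, Fm x x (idm x) = idm (F x)) /\
  (forall x y z (f : hom y z) (g : hom x y),
     Fm x z (compm f g) = compm (Fm y z f) (Fm x y g)).

(* The functor (L, Lm) is left adjoint to (R, Rm). *)
Definition left_adjoint (C D : category)
    (L : D -> C) (Lm : forall x y, hom x y -> hom (L x) (L y))
    (R : C -> D) (Rm : forall x y, hom x y -> hom (R x) (R y)) : Prop :=
  exists phi : forall d c, hom (L d) c -> hom d (R c),
    (forall d c, bijective (phi d c)) /\
    (forall d d' c c' (u : hom d' d) (v : hom c c') (f : hom (L d) c),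
       phi d' c' (compm v (compm f (Lm d' d u))) =
       compm (Rm c c' v) (compm (phi d c f) u)).

Section ModuleCategories.

Lemma rmod_map_id (B : pzRingType) (M : rmodType B) : rmod_map (@id M).
Proof. by []. Qed.
Lemma rmod_map_comp (B : pzRingType) (M N P : rmodType B)
    (f : N -> P) (h : M -> N) :
  rmod_map f -> rmod_map h -> rmod_map (f \o h).
Proof. by case=> fB fZ [hB hZ]; split=> [x y|x a] /=; rewrite ?hB ?fB ?hZ ?fZ. Qed.

Definition mod_cat (B : pzRingType) : category.
Proof.
refine (@Category (rmodType B) (fun M N => {f : M -> N | rmod_map f})
  (fun M => exist _ id (rmod_map_id M))
  (fun M N P f h => exist _ (sval f \o sval h)
     (rmod_map_comp (svalP f) (svalP h))) _ _ _).
- by move=> M N [f fP]; apply: eq_exist.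
- by move=> M N [f fP]; apply: eq_exist.
- by move=> M N P T [f fP] [h hP] [k kP]; apply: eq_exist.
Defined.

Variables (A : pzRingType) (S : aring A).

Record firm_mod := FirmMod {
  firm_mod_sort :> rsmod S;
  firm_modP : firm_right firm_mod_sort
}.

Lemma rsmod_map_id (M : rsmod S) : rsmod_map (@id M).
Proof. by []. Qed.
Lemma rsmod_map_comp (M N P : rsmod S) (f : N -> P) (h : M -> N) :
  rsmod_map f -> rsmod_map h -> rsmod_map (f \o h).
Proof.
case=> fl fS [hl hS]; split=> [|x s] /=; first exact: rmod_map_comp.
by rewrite hS fS.
Qed.

Definition firm_cat : category.
Proof.
refine (@Category firm_mod (fun M N => {f : M -> N | rsmod_map f})
  (fun M => exist _ id (rsmod_map_id M))
  (fun M N P f h => exist _ (sval f \o sval h)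
     (rsmod_map_comp (svalP f) (svalP h))) _ _ _).
- by move=> M N [f fP]; apply: eq_exist.
- by move=> M N [f fP]; apply: eq_exist.
- by move=> M N P T [f fP] [h hP] [k kP]; apply: eq_exist.
Defined.
End ModuleCategories.

Section CoringRing.
Variables (A : pzRingType) (C : coringType A) (gamma : cointegral C).

Lemma cointegralB : zmod_morphism gamma.
Proof. by have [[[+ _] _] _ _] := cointegralP gamma. Qed.
Lemma cointegralD : {morph gamma : s t / s + t}.
Proof. exact/zmod_morphism_morph/cointegralB. Qed.
Lemma cointegralZl (a : A) t : gamma (a *: t) = a * gamma t.
Proof. by have [[[_ +] _] _ _] := cointegralP gamma; apply. Qed.
Lemma cointegralZr t (a : A) : gamma (t :* a) = gamma t * a.
Proof. by have [[_ [_ +]] _ _] := cointegralP gamma; apply. Qed.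
Lemma cointegral_comul c : gamma (comul c) = counit c.
Proof. by have [_ _ +] := cointegralP gamma; apply. Qed.

Lemma comulB : zmod_morphism (comul : C -> tensor C C).
Proof. by have [[+ _] _] := @comul_bimod_map A C. Qed.
Lemma comulZl (a : A) (c : C) : comul (a *: c) = a *: comul c.
Proof. by have [[_ +] _] := @comul_bimod_map A C; apply. Qed.
Lemma comulZr (c : C) (a : A) : comul (c :* a) = comul c :* a.
Proof. by have [_ [_ +]] := @comul_bimod_map A C; apply. Qed.

(* c c' = gamma(c (x) c'_(1)) c'_(2) *)
Definition cmul (c c' : C) : C :=
  tlift (fun x y : C => gamma (c ⊗ x) *: y) (comul c').

Lemma cmul_balanced1 (c : C) :
  balanced (fun x y : C => gamma (c ⊗ x) *: y).
Proof.
split=> [n m m'|m n n'|m a n]; rewrite ?tensDr ?cointegralD ?scalerDl ?scalerDr //.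
by rewrite -tens_rscale cointegralZr scalerA.
Qed.
Lemma cmul_balanced2 (c' : C) :
  balanced (fun x y : C => x :* gamma (y ⊗ c')).
Proof.
split=> [n m m'|m n n'|m a n]; rewrite ?tensDl ?cointegralD ?rscaleDl ?rscaleDr //.
by rewrite -tensZ cointegralZl rscaleA.
Qed.

Lemma cmulE c c' : cmul c c' = tlift (fun x y : C => x :* gamma (y ⊗ c')) (comul c).
Proof. by rewrite /cmul; have [_ + _] := cointegralP gamma; apply. Qed.

Lemma cmulBr c : zmod_morphism (cmul c).
Proof. by move=> x y; rewrite /cmul comulB tlift_additive //; apply: cmul_balanced1. Qed.
Lemma cmulBl c' : zmod_morphism (cmul^~ c').
Proof. by move=> x y; rewrite !cmulE comulB tlift_additive //; apply: cmul_balanced2. Qed.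

Lemma cmulZl a c c' : cmul (a *: c) c' = a *: cmul c c'.
Proof.
have B d := tlift_additive (cmul_balanced1 d).
rewrite /cmul; elim/tensor_ind: (comul c') => [m n|s t IHs IHt].
  by rewrite !(tliftE (cmul_balanced1 _)) -tensZ cointegralZl scalerA.
by rewrite !B IHs IHt scalerBr.
Qed.
Lemma cmulZr c c' a : cmul c (c' :* a) = cmul c c' :* a.
Proof.
have B d := tlift_additive (cmul_balanced1 d).
rewrite /cmul comulZr; elim/tensor_ind: (comul c') => [m n|s t IHs IHt].
  by rewrite tens_rscale !(tliftE (cmul_balanced1 _)) scale_rscaleA.
by rewrite rscaleBl !B IHs IHt rscaleBl.
Qed.
Lemma cmul_balanced : balanced cmul.
Proof.
split=> [c' |c|c a c'].
- exact/zmod_morphism_morph/cmulBl.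
- exact/zmod_morphism_morph/cmulBr.
rewrite /cmul comulZl; have B d := tlift_additive (cmul_balanced1 d).
elim/tensor_ind: (comul c') => [m n|s t IHs IHt].
  by rewrite tensZ !(tliftE (cmul_balanced1 _)) tensA.
by rewrite scalerBr !B IHs IHt.
Qed.

Lemma cointegral_cmul c c' d : gamma (cmul c c' ⊗ d) = gamma (c ⊗ cmul c' d).
Proof.
have B1 e := tlift_additive (cmul_balanced1 e).
have B2 e := tlift_additive (cmul_balanced2 e).
have tBl (x y z : C) : (x - y) ⊗ z = x ⊗ z - y ⊗ z :> tensor C C.
  by apply: (addIr (y ⊗ z)); rewrite -tensDl !subrK.
have tBr (x y z : C) : z ⊗ (x - y) = z ⊗ x - z ⊗ y :> tensor C C.
  by apply: (addIr (z ⊗ y)); rewrite -tensDr !subrK.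
rewrite /cmul -/(cmul c' d) cmulE.
elim/tensor_ind: (comul c') => [m n|s t IHs IHt].
  rewrite (tliftE (cmul_balanced1 _)) (tliftE (cmul_balanced2 _)).
  by rewrite -tensZ -tens_rscale cointegralZl cointegralZr.
by rewrite B1 B2 tBl tBr !cointegralB IHs IHt.
Qed.

Lemma comul_cmul c c' :
  comul (cmul c c') = tlift (fun x y : C => x ⊗ cmul y c' : tensor C C) (comul c).
Proof.
have B2 := tlift_additive (cmul_balanced2 c').
have bal3 : balanced (fun x y : C => x ⊗ cmul y c' : tensor C C).
  split=> [n m m'|m n n'|m a n]; rewrite ?tensDl //.
    by rewrite (zmod_morphism_morph (cmulBl c')) tensDr.
  by rewrite cmulZl tensA.
pose psi (s : tensor C C) : C := tlift (fun x y : C => x :* gamma (y ⊗ c')) s.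
have psiB : zmod_morphism psi := B2.
have psiZ (a : A) t : psi (a *: t) = a *: psi t.
  elim/tensor_ind: t => [m n|s t IHs IHt]; last by rewrite scalerBr !psiB IHs IHt scalerBr.
  by rewrite tensZ /psi !(tliftE (cmul_balanced2 _)) scale_rscaleA.
have balPhi : balanced (fun (x : C) (s : tensor C C) => x ⊗ psi s : tensor C C).
  exact: tmap_balanced.
pose Phi := tmap id psi : tensor C (tensor C C) -> tensor C C.
have PhiB : zmod_morphism Phi by exact: (tlift_additive balPhi).
have PhiE (x : C) s : Phi (x ⊗ s) = x ⊗ psi s by exact: (tliftE balPhi).
have bal4 : balanced (fun x y : C => (comul x : tensor C C) ⊗ y).
  by apply: tmap_balanced => //; [exact: comulB | exact: comulZr].
have bal5 : balanced (fun x y : C => x ⊗ (comul y : tensor C C)).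
  by apply: tmap_balanced => //; [exact: comulB | exact: comulZl].
have := congr1 Phi (comulA c); rewrite cmulE -/(psi (comul c)).
have -> : Phi (tassoc (tmap comul id (comul c))) = comul (psi (comul c)).
  elim/tensor_ind: (comul c) => [m n|s t IHs IHt]; last first.
    by rewrite /tmap (tlift_additive bal4) tassocB PhiB IHs IHt psiB comulB.
  rewrite /tmap (tliftE bal4) /psi (tliftE (cmul_balanced2 _)) comulZr.
  elim/tensor_ind: (comul m) => [x y|s t IHs IHt].
    by rewrite tassocE PhiE /psi (tliftE (cmul_balanced2 _)) tens_rscale.
  have -> : (s - t) ⊗ n = s ⊗ n - t ⊗ n :> tensor (tensor C C) C.
    by apply: (addIr (t ⊗ n)); rewrite -tensDl !subrK.
  by rewrite tassocB PhiB IHs IHt rscaleBl.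
move=> ->; elim/tensor_ind: (comul c) => [m n|s t IHs IHt].
  by rewrite /tmap (tliftE bal5) PhiE (tliftE bal3) cmulE.
by rewrite /tmap (tlift_additive bal5) PhiB IHs IHt (tlift_additive bal3).
Qed.

Lemma cmulA c c' d : cmul c (cmul c' d) = cmul (cmul c c') d.
Proof.
rewrite [RHS]cmulE comul_cmul cmulE.
have bal3 : balanced (fun x y : C => x ⊗ cmul y c' : tensor C C).
  split=> [n m m'|m n n'|m a n]; rewrite ?tensDl //.
    by rewrite (zmod_morphism_morph (cmulBl c')) tensDr.
  by rewrite cmulZl tensA.
elim/tensor_ind: (comul c) => [x y|s t IHs IHt].
  by rewrite (tliftE bal3) !(tliftE (cmul_balanced2 _)) cointegral_cmul.
rewrite (tlift_additive bal3) !(tlift_additive (cmul_balanced2 _)).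
by rewrite IHs IHt.
Qed.

Definition coring_aring : aring A :=
  @ARing A C cmul cmul_balanced cmulZl cmulZr cmulA.
End CoringRing.

Section Invariants.
Variables (A : pzRingType) (C : coringType A).
Variables (gamma : cointegral C) (g : grouplike C).
Local Notation CC := (coring_aring gamma).

Section InvariantsOf.
Variable M : rsmod CC.

Definition invariants : {pred M} :=
  [pred m | `[< forall c : C, ract m (c : CC) = m :* gamma ((g : C) ⊗ c) >]].

Lemma invariantsP (m : M) :
  reflect (forall c : C, ract m (c : CC) = m :* gamma ((g : C) ⊗ c))
          (m \in invariants).
Proof. exact: asboolP. Qed.

Lemma ractDl c : {morph (fun m : M => ract m c) : m m' / m + m'}.
Proof. by have [[+ _ _] _ _] := ractP M; apply. Qed.
Lemma ractBl (m m' : M) c : ract (m - m') c = ract m c - ract m' c.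
Proof. by apply: (addIr (ract m' c)); rewrite -ractDl !subrK. Qed.
Lemma ractAr (m : M) a c : ract (m :* a) c = ract m (a *: c).
Proof. by have [[_ _ +] _ _] := ractP M; apply. Qed.
Lemma ractZr (m : M) c a : ract m (c :* a) = ract m c :* a.
Proof. by have [_ + _] := ractP M; apply. Qed.
Lemma ractA (m : M) c d : ract (ract m c) d = ract m (amul c d).
Proof. by have [_ _ +] := ractP M; apply. Qed.

Lemma invariants_closed : zmod_closed invariants.
Proof.
split=> [|x y /invariantsP xP /invariantsP yP]; apply/invariantsP => c.
  by rewrite rscale0r; have := ractBl 0 0 c; rewrite !subrr.
by rewrite ractBl rscaleBl xP yP.
Qed.
HB.instance Definition _ := GRing.isZmodClosed.Build M invariants
  invariants_closed.

Record inv_type := InvType {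
  inv_val : M;
  inv_valP : inv_val \in invariants
}.
HB.instance Definition _ := [isSub for inv_val].
HB.instance Definition _ := [Choice of inv_type by <:].
HB.instance Definition _ := [SubChoice_isSubZmodule of inv_type by <:].

Lemma inv_ract (m : inv_type) (c : C) :
  ract (val m) (c : CC) = val m :* gamma ((g : C) ⊗ c).
Proof. by case: m => m /= /invariantsP. Qed.
End InvariantsOf.
Arguments invariants M : clear implicits.

(* a . c = gamma(g a (x) c) *)
Definition base_ract (a : A) (c : C) : A := gamma (((g : C) :* a) ⊗ c).

Lemma base_ractP : @is_ract A CC A^o base_ract.
Proof.
rewrite /base_ract; split.
- split=> [c a b|a c d|a b c].
  + by rewrite rscaleDr tensDl cointegralD.
  + by rewrite tensDr cointegralD.
  + by rewrite -tensA rscaleA.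
- by move=> a c b; rewrite -tens_rscale cointegralZr.
- move=> a c d; rewrite /= -cointegral_cmul cmulE comulZr comul_grouplike.
  by rewrite tens_rscale (tliftE (cmul_balanced2 _ _)).
Qed.

Definition base_rsmod : rsmod CC := RSMod base_ractP.

(* B: the membership condition of invariants base_rsmod, written in A so that B
   is a subring of A for the library. *)
Definition base_invariants : {pred A} := [pred b | `[<
  forall c : C, gamma (((g : C) :* b) ⊗ c) = b * gamma ((g : C) ⊗ c) >]].

Lemma base_invariantsP (b : A) :
  reflect (forall c : C, gamma (((g : C) :* b) ⊗ c) = b * gamma ((g : C) ⊗ c))
          (b \in base_invariants).
Proof. exact: asboolP. Qed.

Lemma base_invariants_closed : subring_closed base_invariants.
Proof.
split=> [|x y xP yP|x y /base_invariantsP xP /base_invariantsP yP].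
- by apply/base_invariantsP => c; rewrite rscaler1 mul1r.
- by case: (invariants_closed base_rsmod) => _; apply.
apply/base_invariantsP => c.
by rewrite -rscaleA tensA xP -tensA yP mulrA.
Qed.
HB.instance Definition _ := GRing.isSubringClosed.Build A base_invariants
  base_invariants_closed.

Record base_inv := BaseInv {
  base_val : A;
  base_valP : base_val \in base_invariants
}.
HB.instance Definition _ := [isSub for base_val].
HB.instance Definition _ := [Choice of base_inv by <:].
HB.instance Definition _ := 
  GRing.SubChoice_isSubPzRing.Build A base_invariants base_inv
    base_invariants_closed.

Local Notation B := base_inv.


Section InvariantsModule.
Variable M : rsmod CC.

Lemma inv_rscale_subproof (m : inv_type M) (b : B) :
  val m :* val b \in invariants M.
Proof.
case: b => b /= /base_invariantsP bP; apply/invariantsP => c.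
by rewrite ractAr inv_ract -tensA bP rscaleA.
Qed.
Definition inv_rscale (m : inv_type M) (b : B) : inv_type M :=
  InvType (inv_rscale_subproof m b).

Lemma inv_rscaleA m a b : inv_rscale (inv_rscale m a) b = inv_rscale m (a * b).
Proof. by apply: val_inj; apply: rscaleA. Qed.
Lemma inv_rscale1 m : inv_rscale m 1 = m.
Proof. by apply: val_inj; apply: rscaler1. Qed.
Lemma inv_rscaleDl b : {morph inv_rscale^~ b : m m' / m + m'}.
Proof. by move=> m m'; apply: val_inj; apply: rscaleDl. Qed.
Lemma inv_rscaleDr m : {morph inv_rscale m : a b / a + b}.
Proof. by move=> a b; apply: val_inj; apply: rscaleDr. Qed.
HB.instance Definition _ := isRmodule.Build B (inv_type M)
  inv_rscaleA inv_rscale1 inv_rscaleDl inv_rscaleDr.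
End InvariantsModule.

Definition inv_ob (M : firm_cat CC) : mod_cat B :=
  inv_type (M : firm_mod CC).

Section InvariantsMap.
Variables (M N : firm_cat CC) (f : hom M N).

Lemma inv_map_subproof (m : inv_ob M) : sval f (inv_val m) \in invariants _.
Proof.
case: f => h /= [[_ hZ] hS]; apply/invariantsP => c.
by rewrite -hS inv_ract hZ.
Qed.
Definition inv_fun (m : inv_ob M) : inv_ob N := InvType (inv_map_subproof m).

Lemma inv_fun_rmod_map : rmod_map inv_fun.
Proof.
split=> [x y|x b]; apply: val_inj; rewrite /=; case: f => h /= [[hB hZ] _].
  exact: hB.
exact: hZ.
Qed.
Definition inv_map : hom (inv_ob M) (inv_ob N) := exist _ _ inv_fun_rmod_map.
End InvariantsMap.

(* A copy of A carrying the (B, A)-bimodule structure; its only left scalars are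
   those in B. *)
Definition base_left : Type := A.
HB.instance Definition _ := GRing.Zmodule.on base_left.
HB.instance Definition _ := Rmodule.copy base_left A^o.

Definition base_scale (b : B) (a : base_left) : base_left := (val b : A) * (a : A).
Lemma base_scaleA b b' a : base_scale b (base_scale b' a) = base_scale (b * b') a.
Proof. exact: mulrA. Qed.
Lemma base_scale1 : left_id 1 base_scale.
Proof. exact: mul1r. Qed.
Lemma base_scaleDr : right_distributive base_scale +%R.
Proof. by move=> b; apply: mulrDr. Qed.
Lemma base_scaleDl a : {morph base_scale^~ a : b b' / b + b'}.
Proof. by move=> b b'; apply: mulrDl. Qed.
HB.instance Definition _ := GRing.Zmodule_isLmodule.Build B base_left
  base_scaleA base_scale1 base_scaleDr base_scaleDl.
Lemma base_scale_rscaleA (b : B) (x : base_left) (a : A) :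
  b *: (x :* a) = (b *: x) :* a.
Proof. exact: mulrA. Qed.
HB.instance Definition _ := isBimodule.Build B A base_left base_scale_rscaleA.

Local Notation BB := (regular_aring B).

Lemma base_sbimod_lactP : @is_lact B BB base_left base_scale.
Proof.
split.
- by split=> [a|b|b b' a]; [exact: base_scaleDl|exact: base_scaleDr|
    exact: esym (mulrA _ _ _)].
- by move=> b b' a; exact: esym (mulrA _ _ _).
- by move=> b b' a; exact: mulrA.
Qed.
Lemma base_sbimod_ractP : @is_ract A CC base_left base_ract.
Proof. exact: base_ractP. Qed.
Lemma base_ract_scale (b : B) (a : base_left) (c : C) :
  base_ract (b *: a : base_left) c = b *: (base_ract a c : base_left).
Proof.
case: b => b /= bP; have /base_invariantsP E := bP.
rewrite /base_ract -[LHS]/(gamma (((g : C) :* (b * a)) ⊗ c)).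
by rewrite -rscaleA tensA E -tensA.
Qed.

Definition base_sbimod : sbimod BB CC :=
  @SBimod B A BB CC base_left base_scale base_ract
    base_sbimod_lactP base_sbimod_ractP
    base_scale_rscaleA base_ract_scale base_ract_scale.

(* Q is the invariants of C; the copy also carries the left A-action. *)
Definition Qinv : Type := inv_type (regr CC).
HB.instance Definition _ := GRing.Zmodule.on Qinv.
HB.instance Definition _ := Rmodule.copy Qinv (inv_type (regr CC)).

Lemma Q_scale_subproof (a : A) (q : Qinv) :
  (a *: (inv_val q : C) : regr CC) \in invariants (regr CC).
Proof.
apply/invariantsP => c.
have E : cmul gamma (inv_val q) c = (inv_val q : C) :* gamma ((g : C) ⊗ c).
  exact: inv_ract q c.
by rewrite -[LHS]/(cmul gamma (a *: (inv_val q : C)) c) cmulZl E scale_rscaleA.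
Qed.
Definition Q_scale (a : A) (q : Qinv) : Qinv := InvType (Q_scale_subproof a q).

Lemma Q_lact_subproof (c : C) (q : Qinv) :
  (cmul gamma c (inv_val q) : regr CC) \in invariants (regr CC).
Proof.
apply/invariantsP => d.
have E : cmul gamma (inv_val q) d = (inv_val q : C) :* gamma ((g : C) ⊗ d).
  exact: inv_ract q d.
by rewrite -[LHS]/(cmul gamma (cmul gamma c (inv_val q)) d) -cmulA E cmulZr.
Qed.
Definition Q_lact (c : C) (q : Qinv) : Qinv := InvType (Q_lact_subproof c q).

Lemma Q_scaleA a b q : Q_scale a (Q_scale b q) = Q_scale (a * b) q.
Proof. by apply: val_inj; apply: scalerA. Qed.
Lemma Q_scale1 : left_id 1 Q_scale.
Proof. by move=> q; apply: val_inj; apply: scale1r. Qed.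
Lemma Q_scaleDr : right_distributive Q_scale +%R.
Proof. by move=> a q q'; apply: val_inj; apply: scalerDr. Qed.
Lemma Q_scaleDl q : {morph Q_scale^~ q : a b / a + b}.
Proof. by move=> a b; apply: val_inj; apply: scalerDl. Qed.
HB.instance Definition _ := GRing.Zmodule_isLmodule.Build A Qinv
  Q_scaleA Q_scale1 Q_scaleDr Q_scaleDl.
Lemma Q_scale_rscaleA (a : A) (q : Qinv) (b : B) : a *: (q :* b) = (a *: q) :* b.
Proof. by apply: val_inj; apply: (@scale_rscaleA _ _ C). Qed.
HB.instance Definition _ := isBimodule.Build A B Qinv Q_scale_rscaleA.

Lemma Q_lactP : @is_lact A CC Qinv Q_lact.
Proof.
split.
- split=> [q c d|c q q'|c a q]; apply: val_inj.
  + exact: (zmod_morphism_morph (cmulBl gamma _)).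
  + exact: (zmod_morphism_morph (cmulBr gamma _)).
  + by have [_ _ +] := cmul_balanced gamma; apply.
- by move=> a c q; apply: val_inj; apply: cmulZl.
- by move=> c d q; apply: val_inj; apply: cmulA.
Qed.
Definition Q_ract (q : Qinv) (b : B) : Qinv := q :* b.
Lemma Q_ractP : @is_ract B BB Qinv Q_ract.
Proof.
rewrite /Q_ract; split=> [|q b b'|q b b'].
- split=> [b q q'|q b b'|q b b']; rewrite ?rscaleDl ?rscaleDr //.
  by rewrite rscaleA.
- by rewrite rscaleA.
- by rewrite rscaleA.
Qed.
Lemma Q_lact_rscale (c : C) (q : Qinv) (b : B) :
  Q_lact c (q :* b) = Q_lact c q :* b.
Proof. by apply: val_inj; apply: cmulZr. Qed.
Lemma Q_ract_scale (a : A) (q : Qinv) (b : B) : Q_ract (a *: q) b = a *: Q_ract q b.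
Proof. by rewrite /Q_ract Q_scale_rscaleA. Qed.
Lemma Q_ract_lact (c : C) (q : Qinv) (b : B) :
  Q_ract (Q_lact c q) b = Q_lact c (Q_ract q b).
Proof. by rewrite /Q_ract Q_lact_rscale. Qed.

Definition Q_sbimod : sbimod CC BB :=
  @SBimod A B CC BB Qinv Q_lact Q_ract Q_lactP Q_ractP
    Q_lact_rscale Q_ract_scale Q_ract_lact.
Definition Q_lsmod : lsmod CC := sb_left Q_sbimod.

Section TensorA.
Variable N : rmodType B.

(* (n (x) a) . c = n (x) gamma(g a (x) c) *)
Definition tensBA_ract (t : tensor N base_left) (c : C) : tensor N base_left :=
  tlift (fun (n : N) (a : base_left) => n ⊗ (base_ract a c : base_left)) t.

Let bal (c : C) : balanced (fun (n : N) (a : base_left) =>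
  n ⊗ (base_ract a c : base_left)).
Proof.
have [[Dl _ _] _ _] := base_sbimod_ractP.
split=> [a n n'|n a a'|n b a]; first exact: tensDl.
  by rewrite Dl tensDr.
by rewrite tensA base_ract_scale.
Qed.

Lemma tensBA_ractE (n : N) (a : base_left) c :
  tensBA_ract (n ⊗ a) c = n ⊗ (base_ract a c : base_left).
Proof. exact: (tliftE (bal c)). Qed.
Lemma tensBA_ractB c : zmod_morphism (tensBA_ract^~ c).
Proof. exact: (tlift_additive (bal c)). Qed.

Lemma tensBA_ractP : @is_ract A CC (tensor N base_left) tensBA_ract.
Proof.
have [[_ Dr Ac] Zr As] := base_sbimod_ractP.
have B c s t : tensBA_ract (s - t) c = tensBA_ract s c - tensBA_ract t c.
  exact: tensBA_ractB.
split.
- split=> [c|t c d|t a c]; first exact/zmod_morphism_morph/tensBA_ractB.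
    elim/tensor_ind: t => [n x|s t IHs IHt].
      by rewrite !tensBA_ractE Dr tensDr.
    by rewrite !B IHs IHt opprD addrACA.
  elim/tensor_ind: t => [n x|s t IHs IHt].
    by rewrite tens_rscale !tensBA_ractE Ac.
  by rewrite rscaleBl !B IHs IHt.
- move=> t c a; elim/tensor_ind: t => [n x|s t IHs IHt].
    by rewrite !tensBA_ractE Zr tens_rscale.
  by rewrite !B IHs IHt rscaleBl.
- move=> t c d; elim/tensor_ind: t => [n x|s t IHs IHt].
    by rewrite !tensBA_ractE As.
  by rewrite !B IHs IHt.
Qed.

Definition tensBA : rsmod CC := RSMod tensBA_ractP.
End TensorA.

Section TensorAMap.
Variables (N N' : rmodType B) (u : N -> N').
Hypothesis uP : rmod_map u.

Lemma tensBA_rsmod_map :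
  rsmod_map (tmap u id : tensBA N -> tensBA N').
Proof.
have [uB uZ] := uP.
have ubal : balanced (fun (n : N) (a : base_left) => u n ⊗ a).
  exact: (@tmap_balanced _ _ _ _ _ u id).
have E (n : N) (a : base_left) : tmap u id (n ⊗ a) = u n ⊗ a.
  exact: (tliftE ubal).
have Z : zmod_morphism (tmap u id : tensor N base_left -> tensor N' base_left).
  exact: (tlift_additive ubal).
split=> [|t c]; first split=> // t a.
  elim/tensor_ind: t => [n x|s t IHs IHt]; first by rewrite !tens_rscale !E tens_rscale.
  by rewrite rscaleBl !Z IHs IHt rscaleBl.
elim/tensor_ind: t => [n x|s t IHs IHt].
  by rewrite /= E !tensBA_ractE E.
by rewrite /= !Z !tensBA_ractB !Z IHs IHt.
Qed.
End TensorAMap.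

Section TensorAFunctor.
Hypothesis firm : forall N : rmodType B, firm_right (tensBA N).

Definition tensBA_ob (N : mod_cat B) : firm_cat CC := FirmMod (firm N).
Definition tensBA_map (N N' : mod_cat B) (u : hom N N') :
    hom (tensBA_ob N) (tensBA_ob N') :=
  exist _ (tmap (sval u) id : tensBA N -> tensBA N') (tensBA_rsmod_map (svalP u)).
End TensorAFunctor.
End Invariants.

Arguments invariants {A C} gamma g M.
Arguments tensBA {A C} gamma g N.
Arguments inv_ob {A C} gamma g M.
Arguments inv_map {A C} gamma g M N f.

(* Main.v *)
(* Since gamma(g (x) g) = 1, one has g c = g gamma(g (x) c) and hence g g = g, so
   that Q = C g and M^C = M g. Therefore m |-> m (x) g inverts M (x)_C Q -> M^C, and
   the case M = A gives tau; likewise q |-> q (x) g inverts C (x)_C Q -> Q. The ring C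
   is firm because the comultiplication is a bimodule section of its product, and
   N (x)_B A is firm because its action is inverted by
   n (x) a |-> (n (x) 1) (x) g a. The adjunction sends f : N (x)_B A -> M to
   n |-> f (n (x) 1). *)

Require Import Defs.
From HB Require Import structures.
From mathcomp Require Import all_boot all_algebra.
From mathcomp Require Import boolp.

Set Implicit Arguments.
Unset Strict Implicit.
Unset Printing Implicit Defensive.

Import GRing.Theory.
Local Open Scope ring_scope.

(** Serves for maps whose additivity is only a local hypothesis inside a proof, where no instance
    can be declared. *)
Lemma additive_of (U V : zmodType) (f : U -> V) :
  zmod_morphism f -> exists h : {additive U -> V}, h =1 f.
Proof.
move=> fB; pose fM := GRing.isZmodMorphism.Build U V f fB.
by exists (HB.pack_for {additive U -> V} f fM).
Qed.

(** * Universal property of the tensor product over a non-unital ring *)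

Section STensorTheory.
Variables (A : pzRingType) (S : aring A) (M : rsmod S) (N : lsmod S).

Lemma stensDl (n : N) : {morph (fun m : M => stens m n) : m m' / m + m'}.
Proof. by move=> m m'; rewrite /stens tensDl raddfD. Qed.
Lemma stensDr (m : M) : {morph (fun n : N => stens m n) : n n' / n + n'}.
Proof. by move=> n n'; rewrite /stens tensDr raddfD. Qed.
Lemma stensA (m : M) a (n : N) : stens (m :* a) n = stens m (a *: n).
Proof. by rewrite /stens tensA. Qed.
Lemma stens_act (m : M) s (n : N) : stens (ract m s) n = stens m (lact s n).
Proof. by apply/eqP; rewrite -subr_eq0 /stens -raddfB; apply/eqP/zpi_eq0. Qed.

Lemma stens_balanced : balanced (@stens A S M N).
Proof. by split=> *; [exact: stensDl|exact: stensDr|exact: stensA]. Qed.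

Lemma stensor_ext (G : zmodType) (f h : stensor M N -> G) :
    zmod_morphism f -> zmod_morphism h ->
  (forall m n, f (stens m n) = h (stens m n)) -> f =1 h.
Proof.
move=> fB hB E x; have [t ->] := zpi_surj x.
elim/tensor_ind: t => [|s t IHs IHt]; first exact: E.
by rewrite raddfB fB hB IHs IHt.
Qed.

Section Lift.
Variables (G : zmodType) (f : M -> N -> G).
Hypothesis fP : balanced f.
Hypothesis fA : forall m s n, f (ract m s) n = f m (lact s n).

Lemma stensor_lift :
  exists h : {additive stensor M N -> G}, forall m n, h (stens m n) = f m n.
Proof.
have f0 x : stensor_rel x -> tlift f x = 0.
  by case=> m s n; rewrite (tlift_additive fP) !(tliftE fP) fA subrr.
have [h hE] := additive_of (zlift_is_zmod_morphism (tlift_additive fP) f0).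
exists h => m n.
by rewrite hE /stens (zliftE (tlift_additive fP) f0) (tliftE fP).
Qed.

(** The common pattern of the bijectivity proofs below, with [u] the candidate inverse. The map [h]
    is quantified because [stensor_lift] yields it only through its values on pure tensors, which
    determine it. *)
Lemma stensor_iso (u : G -> stensor M N) : {morph u : x y / x + y} ->
    (forall m n, u (f m n) = stens m n) ->
    (forall h : {additive stensor M N -> G},
       (forall m n, h (stens m n) = f m n) -> cancel u h) ->
  exists2 h : {additive stensor M N -> G},
    forall m n, h (stens m n) = f m n & bijective h.
Proof.
move=> uD uf fu; have [h hE] := stensor_lift; exists h => //.
exists u; last exact: fu.
apply: (@stensor_ext _ (u \o h) id) => // [x y|m n] /=; last by rewrite hE uf.
(* [u] is known to respect sums; adding $u(h(y))$ to both sides turns this into the rule for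
   differences. *)
by apply: (addIr (u (h y))); rewrite -uD -raddfD !subrK.
Qed.
End Lift.
End STensorTheory.

(** * Firmness over a unital ring *)

Section RegularModules.
Variable R : pzRingType.
Local Notation RR := (regular_aring R).

(** The inverse is $m \mapsto m \otimes 1$, because $mb \otimes 1 = m \otimes b$. *)
Lemma firm_right_regular (M : rsmod RR) :
  (forall (m : M) (b : R), ract m (b : RR) = m :* b) -> firm_right M.
Proof.
move=> actE; have [bal _ actA] := ractP M.
apply: (@stensor_iso _ _ M (regl RR) _ _ bal _ (fun m => stens m (1 : R^o))).
- by move=> m s t; rewrite actA.
- by move=> m m'; rewrite stensDl.
- by move=> m b; rewrite actE stensA; congr stens; exact: mulr1.
- by move=> h hE m; rewrite hE actE rscaler1.
Qed.

Lemma firm_left_regular (N : lsmod RR) :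
  (forall (b : R) (n : N), lact (b : RR) n = b *: n) -> firm_left N.
Proof.
move=> actE; have [bal _ actA] := lactP N.
apply: (@stensor_iso _ _ (regr RR) N _ _ bal _ (fun n => stens (1 : R^o) n)).
- by move=> s t n; rewrite actA.
- by move=> n n'; rewrite stensDr.
- by move=> b n; rewrite actE -stensA; congr stens; exact: mul1r.
- by move=> h hE n; rewrite hE actE scale1r.
Qed.

Lemma firm_regular : firm_ring RR.
Proof. by split; [exact: firm_left_regular|exact: firm_right_regular]. Qed.
End RegularModules.

(** * Firmness of the coring as a non-unital ring *)

Section CoringFirm.
Variables (A : pzRingType) (C : coringType A) (gamma : cointegral C).
Local Notation CC := (coring_aring gamma).

(** By coassociativity, $c_{(1)}c_{(2)} = \gamma(c_{(1)} \otimes c_{(2)})c_{(3)} =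
    \epsilon(c_{(1)})c_{(2)} = c$. *)
Lemma cmul_comul (c : C) : tlift (cmul gamma) (comul c) = c.
Proof.
pose b1 x := cmul_balanced1 gamma x; pose b := cmul_balanced gamma.
(* [tlift h] is $x \otimes (u \otimes v) \mapsto \gamma(x \otimes u)v$; it gets applied to both
   sides of coassociativity. *)
pose h (x : C) t := tlift (fun u v : C => gamma (x ⊗ u) *: v) t.
have hB x : zmod_morphism (h x) by exact: tlift_additive (b1 x).
have hE x u v : h x (u ⊗ v) = gamma (x ⊗ u) *: v by exact: tliftE (b1 x) u v.
have hbal : balanced (h : C -> tensor C C -> C).
  split=> [t x y|x|x a t]; last 2 first.
  - exact/zmod_morphism_morph/hB.
  - elim/tensor_ind: t => [u v|s t IHs IHt].
      by rewrite tensZ !hE -tensA.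
    by rewrite scalerBr !hB IHs IHt.
  elim/tensor_ind: t => [u v|s t IHs IHt].
    by rewrite !hE tensDl cointegralD scalerDl.
  by rewrite !hB IHs IHt opprD addrACA.
have bal4 : balanced (fun x y : C => (comul x : tensor C C) ⊗ y).
  by apply: tmap_balanced => //; [exact: comulB | exact: comulZr].
have bal5 : balanced (fun x y : C => x ⊗ (comul y : tensor C C)).
  by apply: tmap_balanced => //; [exact: comulB | exact: comulZl].
have eps : balanced (fun x y : C => counit x *: y).
  have [[eB eZl] [_ eZr]] := @counit_bimod_map A C.
  have eD := zmod_morphism_morph eB.
  by split=> [y x x'|x y y'|x a y]; rewrite ?eD ?scalerDl ?scalerDr ?eZr ?scalerA.
have := congr1 (tlift h) (comulA c).
have -> : tlift h (tmap id comul (comul c)) = tlift (cmul gamma) (comul c).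
  elim/tensor_ind: (comul c) => [x y|s t IHs IHt].
    by rewrite /tmap (tliftE bal5) (tliftE hbal) (tliftE b).
  by rewrite /tmap (tlift_additive bal5) !(tlift_additive hbal)
    (tlift_additive b) IHs IHt.
move=> <-; rewrite -[RHS](counitl c).
elim/tensor_ind: (comul c) => [x y|s t IHs IHt]; last first.
  by rewrite /tmap (tlift_additive bal4) tassocB !(tlift_additive hbal)
    (tlift_additive eps) IHs IHt.
rewrite /tmap (tliftE bal4) (tliftE eps) -(cointegral_comul gamma).
elim/tensor_ind: (comul x) => [u v|s t IHs IHt].
  by rewrite tassocE (tliftE hbal) hE.
have -> : (s - t) ⊗ y = s ⊗ y - t ⊗ y :> tensor (tensor C C) C.
  by apply: (addIr (t ⊗ y)); rewrite -tensDl !subrK.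
by rewrite tassocB (tlift_additive hbal) IHs IHt cointegralB scalerBl.
Qed.

Lemma firm_ring_coring : firm_ring CC.
Proof.
pose M := regr CC; pose N := regl CC.
have sbal := stens_balanced M N.
pose u (c : CC) := tlift (@stens A CC M N) (comul (c : C)) : stensor M N.
have sB := tlift_additive sbal.
have uD : {morph u : c d / c + d}.
  by apply: zmod_morphism_morph => c d; rewrite /u comulB sB.
(* $u(cd) = c_{(1)} \otimes c_{(2)}d = c_{(1)}c_{(2)} \otimes d = c \otimes d$, the first step by
   right linearity of comultiplication over the ring. *)
have uM (c d : CC) : u (amul c d) = stens (c : M) (d : N).
  rewrite /u /= comul_cmul.
  have bal : balanced (fun x y : C => x ⊗ cmul gamma y d : tensor C C).
    apply: tmap_balanced => //; first exact: cmulBl.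
    by move=> a x; exact: cmulZl.
  (* Only the [c] on the right-hand side is expanded, so that both sides become additive in
     [comul c]. *)
  rewrite -{2}(cmul_comul c).
  elim/tensor_ind: (comul c) => [x y|s t IHs IHt].
    by rewrite (tliftE bal) (tliftE sbal) (tliftE (cmul_balanced gamma))
      (@stens_act _ _ M N x y d).
  rewrite (tlift_additive bal) sB IHs IHt (tlift_additive (cmul_balanced gamma)).
  by apply: (addIr (stens (tlift (cmul gamma) t : M) (d : N)));
    rewrite -stensDl !subrK.
(* Left and right firmness concern the same map $\mathcal{C} \otimes_{\mathcal{C}} \mathcal{C} \to
   \mathcal{C}$, so one isomorphism gives both. *)
suff : exists2 f : {additive stensor M N -> C},
    forall m n : C, f (stens (m : M) (n : N)) = cmul gamma m n & bijective f.
  by split.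
apply: (@stensor_iso _ _ M N C (cmul gamma) (cmul_balanced gamma) _ u) => //.
  by move=> c d e; rewrite -[LHS]/(cmul gamma (cmul gamma c d) e) -cmulA.
move=> h hE c; rewrite -[RHS](cmul_comul c) /u.
elim/tensor_ind: (comul c) => [x y|s t IHs IHt].
  by rewrite (tliftE sbal) hE (tliftE (cmul_balanced gamma)).
by rewrite sB raddfB IHs IHt (tlift_additive (cmul_balanced gamma)).
Qed.
End CoringFirm.

(** * Invariants as multiples of the grouplike element *)

Section Invariants.
Variables (A : pzRingType) (C : coringType A).
Variables (gamma : cointegral C) (g : grouplike C).
Local Notation CC := (coring_aring gamma).
Local Notation B := (base_inv gamma g).
Local Notation Q := (Qinv gamma g).
Local Notation BA := (base_left A).

Lemma gamma_grouplike : gamma ((g : C) ⊗ (g : C)) = 1.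
Proof. by rewrite -comul_grouplike cointegral_comul counit_grouplike. Qed.

Lemma cmul_grouplikel (c : C) :
  cmul gamma g c = (g : C) :* gamma ((g : C) ⊗ c).
Proof. by rewrite cmulE comul_grouplike (tliftE (cmul_balanced2 _ _)). Qed.

Lemma grouplike_inv : (g : C) \in invariants gamma g (regr CC).
Proof. apply/invariantsP => c; exact: cmul_grouplikel. Qed.

Definition grouplike_Q : Q := InvType grouplike_inv.

Lemma inv_ract_grouplike (M : rsmod CC) (m : inv_type g M) :
  ract (inv_val m) ((g : C) : CC) = inv_val m.
Proof. by rewrite (inv_ract m) gamma_grouplike rscaler1. Qed.

(** $(mq)c = m(qc) = m(q\gamma(g \otimes c))$, and the last scalar leaves the action. For $M = A$
    this makes $\tau$ land in $B$. *)
Lemma ract_inv (M : rsmod CC) (m : M) (q : Q) :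
  ract m (inv_val q) \in invariants gamma g M.
Proof.
apply/invariantsP => c; rewrite ractA -(ractZr m).
by congr (ract m _); exact: (inv_ract q).
Qed.

(** $mq \otimes g = m \otimes qg = m \otimes q$. This gives one of the two inverse laws for the
    action on $Q$, for $\omega_M$ and for $\tau$. *)
Lemma stens_grouplike_Q (M : rsmod CC) (m : M) (q : Q) :
  stens (ract m (inv_val q)) grouplike_Q = stens m q :> stensor M (Q_lsmod gamma g).
Proof.
rewrite (@stens_act _ _ M (Q_lsmod gamma g) m (inv_val q) grouplike_Q).
by congr stens; apply: val_inj; apply: (inv_ract_grouplike q).
Qed.

Lemma firm_left_Q : firm_left (Q_lsmod gamma g).
Proof.
have [bal _ actA] := lactP (Q_lsmod gamma g).
apply: (@stensor_iso _ _ (regr CC) (Q_lsmod gamma g) _ _ bal _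
  (fun q : Q => stens (inv_val q : regr CC) grouplike_Q)).
- by move=> s t q; rewrite actA.
- by move=> q q'; rewrite (stensDl (M := regr CC)).
- exact: (@stens_grouplike_Q (regr CC)).
- by move=> h hE q; rewrite hE; apply: val_inj; apply: (inv_ract_grouplike q).
Qed.

Lemma omega_bijective (M : rsmod CC) :
  exists2 omega : {additive stensor M (Q_lsmod gamma g) -> inv_type g M},
    forall (m : M) (q : Q), omega (stens m q) = InvType (ract_inv m q)
  & bijective omega.
Proof.
have [[Dl Dr Ar] _ actA] := ractP M.
apply: (@stensor_iso _ _ M (Q_lsmod gamma g) (inv_type g M)
  (fun m q => InvType (ract_inv m q)) _ _
  (fun m => stens (inv_val m) grouplike_Q)).
- split=> [q m m'|m q q'|m a q]; apply: val_inj => /=.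
  + exact: Dl.
  + exact: Dr.
  + exact: Ar.
- by move=> m s q; apply: val_inj; exact: actA.
- by move=> m m'; rewrite stensDl.
- exact: stens_grouplike_Q.
- by move=> h hE m; rewrite hE; apply: val_inj; exact: inv_ract_grouplike.
Qed.

(** * The module $A$ and firmness of the induced modules *)

Lemma base_ract_scaleE (a : A) (c : C) :
  base_ract gamma g a c = gamma ((g : C) ⊗ (a *: c)).
Proof. by rewrite /base_ract tensA. Qed.

(** Shows that $1$ generates $A$ over $\mathcal{C}$: the map $c \mapsto 1 \cdot c$ has the section
    $a \mapsto ga$. *)
Lemma base_ract_grouplike (a : A) : base_ract gamma g 1 ((g : C) :* a) = a.
Proof.
by rewrite base_ract_scaleE scale1r -tens_rscale cointegralZr gamma_grouplike mul1r.
Qed.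

(** Right $\mathcal{C}$-linearity of that section $a \mapsto ga$, so that $A$ is a direct summand of
    $\mathcal{C}$ as a right module. *)
Lemma grouplike_ract (a : A) (c : C) :
  (g : C) :* base_ract gamma g a c = cmul gamma ((g : C) :* a) c.
Proof.
have [_ _ Ac] := cmul_balanced gamma.
by rewrite base_ract_scaleE Ac cmul_grouplikel.
Qed.

(** The condition defining $B$, taken at $c = g$, gives $\gamma(gb \otimes g) = b$. It is used to
    balance the inverse of the action on $N \otimes_B A$. *)
Lemma cmul_grouplike_base (b : B) :
  cmul gamma g (base_val b *: (g : C)) = (g : C) :* base_val b.
Proof.
have /base_invariantsP bP := base_valP b.
by rewrite cmul_grouplikel -tensA bP gamma_grouplike mulr1.
Qed.

Lemma firm_right_tensBA (N : rmodType B) : firm_right (tensBA gamma g N).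
Proof.
pose M := tensBA gamma g N; have [bal _ actA] := ractP M.
pose one n : M := (n ⊗ (1 : BA) : tensor N BA).
pose f (n : N) (a : BA) : stensor M (regl CC) :=
  stens (one n) (((g : C) :* (a : A)) : regl CC).
have one_act n c : ract (one n) c = n ⊗ (base_ract gamma g 1 c : BA).
  exact: tensBA_ractE.
have fD n : {morph f n : a a' / a + a'}.
  by move=> a a'; rewrite /f rscaleDr (stensDr (N := regl CC)).
have oneg n : ract (one n) ((g : C) : CC) = one n.
  by rewrite one_act -[X in base_ract _ _ _ X](rscaler1 (g : C)) base_ract_grouplike.
have fP : balanced f.
  split=> [a n n'|n|n b a]; [|exact: fD|].
    by rewrite /f /one tensDl (stensDl (M := M)).
  have oneb : one (n :* b) = one n :* base_val b.
    rewrite /one tensA [RHS]tens_rscale; congr tens.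
    by rewrite -[LHS]/(base_val b * 1) -[RHS]/(1 * base_val b) mulr1 mul1r.
  (* Inserting g gives g b g a, and g b g = g b. *)
  rewrite /f oneb stensA -{1}oneg (stens_act (M := M) (N := regl CC)); congr stens.
  rewrite -[LHS]/(cmul gamma g (base_val b *: ((g : C) :* a))) scale_rscaleA cmulZr.
  by rewrite cmul_grouplike_base rscaleA.
pose u (t : M) := tlift f (t : tensor N BA).
have uB : zmod_morphism u by exact: tlift_additive fP.
have uE n a : u (n ⊗ a) = f n a by exact: (tliftE fP).
apply: (@stensor_iso _ _ M (regl CC) _ _ bal _ u).
- by move=> t c d; rewrite actA.
- exact: zmod_morphism_morph.
- move=> t c; elim/tensor_ind: (t : tensor N BA) => [n a|s s' IHs IHs'].
    (* $(n \otimes 1) \otimes g(a \cdot c) = (n \otimes 1) \otimes (ga)c = (n \otimes 1) \cdot ga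
       \otimes c = (n \otimes a) \otimes c$. *)
    rewrite -[ract _ _]/(tensBA_ract (n ⊗ a) c) tensBA_ractE uE /f.
    rewrite (_ : _ :* _ = cmul gamma ((g : C) :* a) c); last exact: grouplike_ract.
    rewrite -(stens_act (M := M) (N := regl CC)) one_act base_ract_grouplike.
    by [].
  rewrite (ractBl (M := M)) uB IHs IHs'.
  by apply: (addIr (stens (s' : M) (c : regl CC)));
    rewrite -(stensDl (M := M)) !subrK.
move=> h hE t; elim/tensor_ind: (t : tensor N BA) => [n a|s s' IHs IHs'].
  by rewrite uE hE one_act base_ract_grouplike.
by rewrite uB raddfB IHs IHs'.
Qed.

(** The inverse is $a \mapsto 1 \otimes ga$, by the same computation as for $N \otimes_B A$ with $N$
    left out. *)
Lemma firm_right_base : firm_right (sb_right (base_sbimod gamma g)).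
Proof.
pose M := sb_right (base_sbimod gamma g); have [bal _ actA] := ractP M.
apply: (@stensor_iso _ _ M (regl CC) _ _ bal _
  (fun a : BA => stens (1 : M) (((g : C) :* a) : regl CC))).
- by move=> m s t; rewrite actA.
- by move=> a a'; rewrite rscaleDr (stensDr (N := regl CC)).
- move=> a c; rewrite grouplike_ract -(stens_act (N := regl CC)).
  by congr stens; exact: base_ract_grouplike.
- by move=> h hE a; rewrite hE; exact: base_ract_grouplike.
Qed.
End Invariants.

(** * The adjunction between induction and invariants *)

Section Adjunction.
Variables (A : pzRingType) (C : coringType A).
Variables (gamma : cointegral C) (g : grouplike C).
Local Notation CC := (coring_aring gamma).
Local Notation B := (base_inv gamma g).
Local Notation BA := (base_left A).

Lemma inv_map_functor : is_functor (inv_map gamma g).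
Proof.
split=> [M|M N P f h]; apply: eq_exist; apply/funext => m; apply: val_inj => //=.
Qed.

Variable firm : forall N : rmodType B, firm_right (tensBA gamma g N).

Lemma tmap_baseE (N N' : rmodType B) (u : N -> N') : rmod_map u ->
  forall (n : N) (a : BA), tmap u id (n ⊗ a) = u n ⊗ a.
Proof.
by case=> uB uZ n a; rewrite /tmap (tliftE (@tmap_balanced _ _ _ _ _ u id _ _ _ _)).
Qed.
Lemma tmap_baseB (N N' : rmodType B) (u : N -> N') : rmod_map u ->
  zmod_morphism (tmap u (id : BA -> BA)).
Proof.
by case=> uB uZ; exact: (tlift_additive (@tmap_balanced _ _ _ _ _ u id _ _ _ _)).
Qed.

Lemma tensBA_functor : is_functor (tensBA_map firm).
Proof.
split=> [N|N N' N'' u v]; apply: eq_exist; apply/funext.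
  apply: tensor_ext => //=; first exact: tmap_baseB.
  by move=> n a; rewrite tmap_baseE.
have uB := tmap_baseB (svalP u); have vB := tmap_baseB (svalP v).
apply: tensor_ext => [|s t|n a] /=.
- by apply: tmap_baseB; apply: rmod_map_comp; exact: svalP.
- by rewrite vB uB.
rewrite !tmap_baseE //; first exact: svalP.
- exact: svalP.
by apply: rmod_map_comp; exact: svalP.
Qed.

Lemma tens1_ract (N : rmodType B) (n : N) (c : C) :
  ract ((n ⊗ (1 : BA) : tensor N BA) : tensBA gamma g N) (c : CC) =
  n ⊗ (gamma ((g : C) ⊗ c) : BA).
Proof.
by rewrite -[LHS]/(tensBA_ract _ c) tensBA_ractE /base_ract rscaler1.
Qed.

(** Makes $n \mapsto n \otimes 1$ available as the unit of the adjunction. *)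
Lemma unit_inv (N : rmodType B) (n : N) :
  ((n ⊗ (1 : BA) : tensor N BA) : tensBA gamma g N) \in
    invariants gamma g (tensBA gamma g N).
Proof.
apply/invariantsP => c; rewrite tens1_ract [RHS]tens_rscale; congr tens.
by rewrite -[RHS]/(1 * gamma ((g : C) ⊗ c)) mul1r.
Qed.

Section Transpose.
Variables (N : mod_cat B) (M : firm_cat CC).

Lemma tens1_scale (n : N) (b : B) :
  ((n :* b) ⊗ (1 : BA) : tensor N BA) = (n ⊗ (1 : BA) : tensor N BA) :* base_val b.
Proof.
rewrite tensA [RHS]tens_rscale; congr tens.
by rewrite -[LHS]/(base_val b * 1) -[RHS]/(1 * base_val b) mulr1 mul1r.
Qed.

Lemma adj_inv_subproof (f : Defs.hom (tensBA_ob firm N) M) (n : N) :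
  sval f (n ⊗ (1 : BA) : tensor N BA) \in invariants gamma g (M : firm_mod CC).
Proof.
have [[fB fZ] fS] := svalP f.
apply/invariantsP => c.
by rewrite -fS (inv_ract (InvType (unit_inv n))) fZ.
Qed.
Definition adj_fun (f : Defs.hom (tensBA_ob firm N) M) (n : N) : inv_ob gamma g M :=
  InvType (adj_inv_subproof f n).
Lemma adj_fun_rmod_map f : rmod_map (adj_fun f).
Proof.
have [[fB fZ] fS] := svalP f.
split=> [n n'|n b]; apply: val_inj => /=.
  rewrite -fB; congr (sval f _).
  by apply: (addIr (n' ⊗ (1 : BA))); rewrite -tensDl !subrK.
by rewrite tens1_scale fZ.
Qed.
Definition adj_hom (f : Defs.hom (tensBA_ob firm N) M) : Defs.hom N (inv_ob gamma g M) :=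
  exist _ (adj_fun f) (adj_fun_rmod_map f).

Lemma coadj_balanced (h : Defs.hom N (inv_ob gamma g M)) :
  balanced (fun (n : N) (a : BA) => inv_val (sval h n) :* (a : A)).
Proof.
have [/zmod_morphism_morph hD hZ] := svalP h.
split=> [a n n'|n a a'|n b a].
- by rewrite hD -rscaleDl.
- exact: rscaleDr.
- by rewrite hZ -rscaleA.
Qed.
Definition coadj_fun (h : Defs.hom N (inv_ob gamma g M)) (t : tensBA gamma g N) :
    (M : firm_mod CC) :=
  tlift (fun (n : N) (a : BA) => inv_val (sval h n) :* (a : A)) t.
(** $\mathcal{C}$-linearity rests on the invariance of $h(n)$: $h(n)a \cdot c = h(n) \cdot ac =
    h(n)\gamma(g \otimes ac) = h(n)(a \cdot c)$. *)
Lemma coadj_rsmod_map h : rsmod_map (coadj_fun h).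
Proof.
have hB : zmod_morphism (coadj_fun h) := tlift_additive (coadj_balanced h).
have hE n a : coadj_fun h (n ⊗ a) = _ := tliftE (coadj_balanced h) n a.
split=> [|t c]; first split=> // t a.
  elim/tensor_ind: (t : tensor N BA) => [n a'|s s' IHs IHs'].
    by rewrite [_ :* a]tens_rscale !hE rscaleA.
  by rewrite (rscaleBl (V := tensor N BA)) !hB rscaleBl IHs IHs'.
elim/tensor_ind: (t : tensor N BA) => [n a|s s' IHs IHs'].
  rewrite -[ract _ _]/(tensBA_ract (n ⊗ a) c) tensBA_ractE !hE.
  by rewrite ractAr (inv_ract (sval h n)) base_ract_scaleE.
by rewrite (ractBl (M := tensBA gamma g N)) !hB (ractBl (M := M)) IHs IHs'.
Qed.
Definition coadj_hom (h : Defs.hom N (inv_ob gamma g M)) : Defs.hom (tensBA_ob firm N) M :=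
  exist _ (coadj_fun h) (coadj_rsmod_map h).

Lemma adj_homK : cancel adj_hom coadj_hom.
Proof.
case=> f fP; apply: eq_exist; apply/funext; set F := exist _ _ _.
have [[fB fZ] fS] := fP.
apply: (@tensor_ext _ N BA) => // [|n a].
  exact: (tlift_additive (coadj_balanced (adj_hom F))).
(* $f(n \otimes 1)a = f((n \otimes 1)a) = f(n \otimes a)$. *)
rewrite /= /coadj_fun (tliftE (coadj_balanced (adj_hom F))) /= -fZ.
congr (f _); rewrite [LHS]tens_rscale; congr tens; exact: mul1r.
Qed.
Lemma coadj_homK : cancel coadj_hom adj_hom.
Proof.
case=> h hP; apply: eq_exist; apply/funext => n; apply: val_inj => /=.
by rewrite /coadj_fun (tliftE (coadj_balanced (exist _ h hP))) rscaler1.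
Qed.
End Transpose.

Lemma tensBA_left_adjoint : left_adjoint (tensBA_map firm) (inv_map gamma g).
Proof.
exists adj_hom; split=> [N M|N N' M M' u v f].
  by exists (@coadj_hom N M); [exact: adj_homK|exact: coadj_homK].
(* Naturality: both sides send $n$ to $v(f(u(n) \otimes 1))$. *)
apply: eq_exist; apply/funext => n; apply: val_inj => /=.
by rewrite tmap_baseE //; exact: svalP.
Qed.
End Adjunction.

(** * The Morita context *)

Section Context.
Variables (A : pzRingType) (C : coringType A).
Variables (gamma : cointegral C) (g : grouplike C).
Local Notation CC := (coring_aring gamma).
Local Notation B := (base_inv gamma g).
Local Notation Q := (Qinv gamma g).
Local Notation V := (base_sbimod gamma g).
Local Notation W := (Q_sbimod gamma g).

(** Membership in [base_invariants] is convertible to invariance in [base_rsmod], so [ract_inv]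
    applies. *)
Lemma base_invariants_ract (a : A) (q : Q) :
  base_ract gamma g a (inv_val q) \in base_invariants gamma g.
Proof. exact: (@ract_inv _ _ _ _ (base_rsmod gamma g) a q). Qed.

(** The argument for $\omega_A$, repeated with values in the ring [base_inv] instead of [inv_type];
    the inverse is $b \mapsto b \otimes g$. *)
Lemma tau_bijective :
  exists2 tau : {additive stensor (sb_right V) (sb_left W) -> regular_aring B},
    forall (a : A) (q : Q),
      base_val (tau (stens (a : sb_right V) (q : sb_left W))) =
        base_ract gamma g a (inv_val q)
  & bijective tau.
Proof.
have [[Dl Dr Ar] _ actA] := base_ractP gamma g.
pose f (a : sb_right V) (q : sb_left W) : regular_aring B :=
  BaseInv (base_invariants_ract a q).
suff [tau tauE tauK] : exists2 tau : {additive stensor (sb_right V) (sb_left W) ->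
    regular_aring B}, forall m n, tau (stens m n) = f m n & bijective tau.
  by exists tau => // a q; rewrite tauE.
apply: (@stensor_iso _ _ _ _ _ f _ _
  (fun b : B => stens (base_val b : sb_right V) (grouplike_Q gamma g : sb_left W))).
- split=> [q a a'|a q q'|a a' q]; apply: val_inj => /=.
  + exact: Dl.
  + exact: Dr.
  + exact: Ar.
- by move=> a c q; apply: val_inj; exact: actA.
- by move=> b b'; rewrite (stensDl (M := sb_right V)).
- exact: (@stens_grouplike_Q _ _ _ _ (sb_right V)).
- move=> h hE b; rewrite hE; apply: val_inj => /=.
  have /base_invariantsP bP := base_valP b.
  by rewrite /base_ract bP gamma_grouplike mulr1.
Qed.

Lemma sigma_exists :
  exists sigma : {additive stensor (sb_right W) (sb_left V) -> CC},
    forall (q : Q) (a : A),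
      sigma (stens (q : sb_right W) (a : sb_left V)) = inv_val q :* a.
Proof.
pose f (q : sb_right W) (a : sb_left V) : CC := inv_val (q : Q) :* (a : A).
have [sigma sigmaE] : exists h : {additive stensor (sb_right W) (sb_left V) -> CC},
  forall q a, h (stens q a) = f q a; last by exists sigma.
apply: stensor_lift.
- split=> [a q q'|q a a'|q b a].
  + exact: rscaleDl.
  + exact: rscaleDr.
  + exact: rscaleA.
(* $B$ acts as a ring just as it does by scalars, so its relation is the balancing condition
   again. *)
- by move=> q b a; exact: rscaleA.
Qed.

Lemma firm_base_sbimod : sb_firm V.
Proof. by split; [exact: firm_left_regular|exact: firm_right_base]. Qed.
Lemma firm_Q_sbimod : sb_firm W.
Proof. by split; [exact: firm_left_Q|exact: firm_right_regular]. Qed.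
End Context.

Theorem theorem3p2 (A : pzRingType) (C : coringType A) (hC : coseparable C)
    (gamma : cointegral C) (g : grouplike C) :
  let CC := coring_aring gamma in
  let B := base_inv gamma g in
  let Q := Qinv gamma g in
  let isQ := invariants gamma g (regr CC) in
  (* (1) *)
  ((forall b : A, (b \in base_invariants gamma g) =
      ((b : base_rsmod gamma g) \in invariants gamma g (base_rsmod gamma g))) /\
   GRing.subring_closed (base_invariants gamma g)) /\
  (* (2) *)
  (is_functor (inv_map gamma g) /\
   exists firm : forall N : rmodType B, firm_right (tensBA gamma g N),
     is_functor (tensBA_map firm) /\
     left_adjoint (tensBA_map firm) (inv_map gamma g)) /\
  (* (3) *)
  (left_ideal isQ /\ firm_left (Q_lsmod gamma g) /\
   (forall (q : C) (b : A), q \in isQ -> b \in base_invariants gamma g ->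
      q :* b \in isQ)) /\
  (* (4) *)
  (forall M : firm_mod CC,
     exists2 omega : {additive stensor M (Q_lsmod gamma g) -> inv_type g M},
       forall (m : M) (q : Q), inv_val (omega (stens m q)) = ract m (inv_val q)
     & bijective omega) /\
  (* (5) *)
  (exists (sigma : {additive stensor (sb_right (Q_sbimod gamma g))
                                     (sb_left (base_sbimod gamma g)) -> CC})
          (tau : {additive stensor (sb_right (base_sbimod gamma g))
                                   (sb_left (Q_sbimod gamma g)) ->
                           regular_aring B}),
     [/\ forall (q : Q) (a : A), sigma (stens q a) = inv_val q :* a,
         forall (a : A) (q : Q),
           base_val (tau (stens a q)) = gamma (((g : C) :* a) ⊗ (inv_val q : C)),
         morita_context tau sigma,
         forall b : B, exists t, tau t = b
       & bijective tau]).
Proof.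
move=> CC B Q isQ; split; first by split=> //; exact: base_invariants_closed.
split.
  split; first exact: inv_map_functor.
  exists (@firm_right_tensBA _ _ gamma g).
  by split; [exact: tensBA_functor|exact: tensBA_left_adjoint].
split.
  split; first split; first exact: invariants_closed.
  - by move=> a q qP; exact: (Q_scale_subproof a (InvType qP)).
  - by move=> c q qP; exact: (Q_lact_subproof c (InvType qP)).
  split=> [|q b qP bP]; first exact: firm_left_Q.
  exact: (inv_rscale_subproof (InvType qP) (BaseInv bP)).
split.
  move=> M; have [omega omegaE omegaK] := omega_bijective g M.
  by exists omega => // m q; rewrite omegaE.
have [sigma sigmaE] := sigma_exists gamma g.
have [tau tauE tauK] := tau_bijective gamma g.
have B_inj (b b' : B) : base_val b = base_val b' -> b = b' by exact: val_inj.
exists sigma, tau; split=> //; last first.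
  by move=> b; have [u _ uK] := tauK; exists (u b); rewrite uK.
split.
- exact: firm_regular.
- exact: firm_ring_coring.
- exact: firm_base_sbimod.
- exact: firm_Q_sbimod.
- split.
  + exact: raddfB.
  + move=> b v w; apply: B_inj; rewrite tauE.
    rewrite -[RHS]/(base_val b * base_val (tau (stens v w))) tauE.
    exact: (base_ract_scale (gamma := gamma) b v (inv_val w)).
  + move=> v w b; apply: B_inj; rewrite tauE.
    rewrite -[RHS]/(base_val (tau (stens v w)) * base_val b) tauE.
    by rewrite /base_ract -tens_rscale cointegralZr.
  (* The actions of the ring $B$ are its scalar actions, so the two computations above recur. *)
  + move=> b v w; apply: B_inj; rewrite tauE.
    rewrite -[RHS]/(base_val b * base_val (tau (stens v w))) tauE.
    exact: (base_ract_scale (gamma := gamma) b v (inv_val w)).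
  + move=> v w b; apply: B_inj; rewrite tauE.
    rewrite -[RHS]/(base_val (tau (stens v w)) * base_val b) tauE.
    by rewrite /base_ract -tens_rscale cointegralZr.
- split.
  + exact: raddfB.
  + by move=> a w v; rewrite !sigmaE; symmetry; exact: scale_rscaleA.
  + by move=> w v a; rewrite !sigmaE; symmetry; exact: rscaleA.
  + by move=> c w v; rewrite !sigmaE; symmetry; exact: cmulZr.
  (* $(wv)c = w(vc) = w\gamma(g \otimes vc) = w(v \cdot c)$, by invariance of $w$. *)
  + move=> w v c; rewrite !sigmaE.
    have [_ _ Ac] := cmul_balanced gamma.
    rewrite -[RHS]/(cmul gamma (inv_val w :* v) c) Ac.
    rewrite -[RHS]/(ract (inv_val (w : Qinv gamma g)) (v *: c : CC)).
    rewrite (inv_ract (w : Qinv gamma g)).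
    by congr (_ :* _); exact: base_ract_scaleE.
(* $(wv)w' = w(vw') = w\gamma(g \otimes vw') = w\tau(v \otimes w')$, again by invariance of $w$. *)
- move=> w w' v; apply: val_inj => /=; rewrite sigmaE.
  rewrite -[RHS]/(inv_val (w : Qinv gamma g) :* base_val _) tauE.
  have [_ _ Ac] := cmul_balanced gamma.
  rewrite -[LHS]/(cmul gamma (inv_val w :* v) (inv_val w')) Ac.
  rewrite -[LHS]/(ract (inv_val (w : Qinv gamma g)) (v *: inv_val w' : CC)).
  rewrite (inv_ract (w : Qinv gamma g)).
  by congr (_ :* _); rewrite base_ract_scaleE.
(* $\gamma(gv \otimes w)v' = \gamma(gv \otimes wv')$, by right linearity of $\gamma$. *)
- move=> v v' w; rewrite -[LHS]/(base_val _ * v') tauE sigmaE.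
  by rewrite -[RHS]/(base_ract _ _ _ _) /base_ract -tens_rscale cointegralZr.
Qed.
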